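(* Let $\varphi\colon\mathcal{H}_0\to\mathbb{C}$ be a Shapovalov-regular linear functional, and let $L_0$, $\Omega$, $\psi$, $\Psi$, $\Phi=\Psi\circ\psi$ be the maps defined in the context. Let $L=(1-x^2)\partial_x^2-2x\,\partial_x$ be the classical Legendre differential operator on $\mathbb{C}[x]$. Then: (i) $\psi\colon M(\varphi)\to\mathbb{C}[\zeta]$ is a well-defined surjective linear map sending each level-$n$ weight space $M(\varphi)[-n]$ to the line $\mathbb{C}\cdot\zeta^n$, i.e. $\psi(M(\varphi)[-n])=\mathbb{C}\cdot\zeta^n$. (ii) $\Phi$ sends each level-$n$ weight space to the line $\mathbb{C}\cdot P_n(x)\subset\mathbb{C}[x]$, i.e. $\Phi(M(\varphi)[-n])=\mathbb{C}\cdot P_n(x)$. (iii) $\Phi$ intertwines the action of $\Omega$ on $M(\varphi)$ with the action of $L$ on $\mathbb{C}[x]$: $$\Phi(\Omega\cdot v)=L(\Phi(v))\qquad\text{for all }v\in M(\varphi).$$ (iv) Equivalently, for every $n\ge0$ and every $v\in M(\varphi)[-n]$, $$L(\Phi(v))=-n(n+1)\,\Phi(v).$$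
   Context: $\mathcal{H}=\mathcal{H}_2$ denotes the complex Lie algebra with basis $\{b_k:k\in\mathbb{Z}\}\cup\{c\}$, with $c$ central and $[b_k,b_l]=k\,\delta_{k+l,0}\,\omega_1\,c$, where $\omega_1>0$ is a fixed real constant. (It is the Heisenberg subalgebra attached to the genus-zero curve $u^2=1-2at+t^2$, the case $m=2$, $r=1$; only these brackets are used.) Put $\mathcal{H}_+=\bigoplus_{k>0}\mathbb{C}b_k$, $\mathcal{H}_0=\mathbb{C}b_0\oplus\mathbb{C}c$, $\mathcal{H}_-=\bigoplus_{k<0}\mathbb{C}b_k$. For a linear functional $\varphi\colon\mathcal{H}_0\to\mathbb{C}$, the Verma module is $M(\varphi)=U(\mathcal{H})\otimes_{U(\mathcal{H}_+\oplus\mathcal{H}_0)}\mathbb{C}_\varphi$, where $\mathbb{C}_\varphi$ is one-dimensional, $b_k$ ($k>0$) acts by $0$, and $b_0$, $c$ act by $\varphi(b_0)$, $\varphi(c)$; $v_\varphi$ is the image of $1$. For a partition $\lambda=(\lambda_1\ge\dots\ge\lambda_s>0)$ write $b_{-\lambda}v_\varphi:=b_{-\lambda_1}\cdots b_{-\lambda_s}v_\varphi$ (a PBW monomial, of level $|\lambda|$). These vectors form a basis of $M(\varphi)$; the level-$n$ weight space $M(\varphi)[-n]$ is the span of those with $\lambda\vdash n$. Let $\omega$ be the anti-automorphism of $U(\mathcal{H})$ with $\omega(b_k)=b_{-k}$, $\omega(c)=c$. The Shapovalov form $\mathcal{S}_\varphi$ is the unique symmetric bilinear form on $M(\varphi)$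 with $\mathcal{S}_\varphi(v_\varphi,v_\varphi)=1$, $\mathcal{S}_\varphi(xv,w)=\mathcal{S}_\varphi(v,\omega(x)w)$ for $x\in U(\mathcal{H})$, and distinct spaces $M(\varphi)[-n]$ mutually orthogonal. $\varphi$ is Shapovalov-regular if the Gram matrix of $\mathcal{S}_\varphi$ on $M(\varphi)[-n]$ in the basis $\{b_{-\lambda}v_\varphi:\lambda\vdash n\}$ has nonzero determinant for every $n\ge1$; this is equivalent to $\varphi(c)\ne0$. Put $q:=\omega_1\varphi(c)$ and $\mathsf{L}:=\sum_{k\ge1}b_{-k}b_k$, an element of the completion of $U(\mathcal{H})$ along the grading; it acts on $M(\varphi)$ since only finitely many terms act non-trivially on a given vector. For $\varphi$ Shapovalov-regular set $L_0:=q^{-1}\mathsf{L}$ and $\Omega:=-L_0(L_0+\mathrm{Id})$, as operators on $M(\varphi)$. $\psi\colon M(\varphi)\to\mathbb{C}[\zeta]$ is the linear map with $\psi(b_{-n_1}\cdots b_{-n_s}v_\varphi)=\zeta^{n_1+\cdots+n_s}$ on PBW monomials. $P_n(x)$ are the Legendre polynomials with $P_n(1)=1$. $\Psi\colon\mathbb{C}[\zeta]\to\mathbb{C}[x]$ is the linear isomorphism with $\Psi(\zeta^n)=P_n(x)$. $\Phi:=\Psi\circ\psi$. *)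

(* Defs.v *)
From HB Require Import structures.
From mathcomp Require Import all_boot all_order all_algebra.
From mathcomp Require Import boolp classical_sets fsbigop reals.
From mathcomp Require Import complex finmap monalg.

Set Implicit Arguments.
Unset Strict Implicit.
Unset Printing Implicit Defensive.

Import Order.TTheory GRing.Theory Num.Theory.

Local Open Scope classical_set_scope.
Local Open Scope ring_scope.
Local Open Scope quotient_scope.

HB.mixin Record isLieAlgebra (K : fieldType) L of GRing.Lmodule K L := {
  bracket : L -> L -> L;
  bracket_linearl : forall y, linear (bracket^~ y);
  bracket_linearr : forall x, linear (bracket x);
  bracketxx : forall x, bracket x x = 0;
  jacobi : forall x y z,
    bracket x (bracket y z) + bracket y (bracket z x)
      + bracket z (bracket x y) = 0
}.

#[short(type="lieAlgType")]
HB.structure Definition LieAlgebra (K : fieldType) :=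
  { L of GRing.Lmodule K L & isLieAlgebra K L }.

(* Linear maps from a Lie algebra to an associative algebra carrying the
   bracket to the commutator. *)
HB.mixin Record isLieMorphism (K : fieldType) (L : lieAlgType K)
    (A : algType K) (f : L -> A) := {
  lie_morph : forall x y, f (bracket x y) = f x * f y - f y * f x
}.

HB.structure Definition LieMorphism (K : fieldType) (L : lieAlgType K)
    (A : algType K) :=
  { f of @GRing.Linear K L A *:%R f & isLieMorphism K L A f }.

Notation "{ 'liemorphism' L -> A }" := (LieMorphism.type L A)
  (at level 0, L at level 98, A at level 99,
   format "{ 'liemorphism'  L  ->  A }") : type_scope.

Section EnvelopingAlgebra.
Variables (K : fieldType) (L : lieAlgType K).

Inductive uterm : Type :=
  | UConst of K
  | UGen of L
  | UAdd of uterm & uterm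
  | UMul of uterm & uterm.

(* The least congruence making [uterm] a unital associative K-algebra in which
   [UGen] is linear and carries the bracket to the commutator. *)
Inductive ueq : uterm -> uterm -> Prop :=
  | ueq_refl t : ueq t t
  | ueq_sym s t : ueq s t -> ueq t s
  | ueq_trans s t r : ueq s t -> ueq t r -> ueq s r
  | ueq_add s s' t t' : ueq s s' -> ueq t t' -> ueq (UAdd s t) (UAdd s' t')
  | ueq_mul s s' t t' : ueq s s' -> ueq t t' -> ueq (UMul s t) (UMul s' t')
  | ueq_addA s t r : ueq (UAdd s (UAdd t r)) (UAdd (UAdd s t) r)
  | ueq_addC s t : ueq (UAdd s t) (UAdd t s)
  | ueq_add0 t : ueq (UAdd (UConst 0) t) t
  | ueq_addN t : ueq (UAdd (UMul (UConst (-1)) t) t) (UConst 0)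
  | ueq_mulA s t r : ueq (UMul s (UMul t r)) (UMul (UMul s t) r)
  | ueq_mul1 t : ueq (UMul (UConst 1) t) t
  | ueq_mulDl s t r : ueq (UMul (UAdd s t) r) (UAdd (UMul s r) (UMul t r))
  | ueq_mulDr s t r : ueq (UMul r (UAdd s t)) (UAdd (UMul r s) (UMul r t))
  | ueq_constD a b : ueq (UConst (a + b)) (UAdd (UConst a) (UConst b))
  | ueq_constM a b : ueq (UConst (a * b)) (UMul (UConst a) (UConst b))
  | ueq_constC a t : ueq (UMul (UConst a) t) (UMul t (UConst a))
  | ueq_genP a x y :
      ueq (UGen (a *: x + y)) (UAdd (UMul (UConst a) (UGen x)) (UGen y))
  | ueq_genB x y :
      ueq (UMul (UGen x) (UGen y))
          (UAdd (UMul (UGen y) (UGen x)) (UGen (bracket x y))).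

HB.instance Definition _ := gen_eqMixin uterm.
HB.instance Definition _ := gen_choiceMixin uterm.

Definition ueqb : rel uterm := fun s t => `[< ueq s t >].

Lemma ueqb_refl : reflexive ueqb.
Proof. by move=> t; apply/asboolP; exact: ueq_refl. Qed.

Lemma ueqb_sym : symmetric ueqb.
Proof. by move=> s t; apply/asboolP/asboolP; exact: ueq_sym. Qed.

Lemma ueqb_trans : transitive ueqb.
Proof.
by move=> s t r /asboolP ts /asboolP sr; apply/asboolP; exact: ueq_trans sr.
Qed.

Canonical ueqb_equiv := EquivRel ueqb ueqb_refl ueqb_sym ueqb_trans.

Definition envel : Type := {eq_quot ueqb}.

HB.instance Definition _ := Choice.on envel.
HB.instance Definition _ := Quotient.on envel.

Definition upi (t : uterm) : envel := \pi_envel t.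

Lemma upiP s t : upi s = upi t <-> ueq s t.
Proof.
by split=> [/(@eqmodP _ ueqb_equiv) /asboolP //|st]; apply/eqmodP/asboolP.
Qed.

Lemma upi_repr u : upi (repr u) = u.
Proof. exact: reprK. Qed.

Lemma ueq_repr t : ueq (repr (upi t)) t.
Proof. by apply/upiP; rewrite upi_repr. Qed.

Lemma envelP (P : envel -> Prop) : (forall t, P (upi t)) -> forall u, P u.
Proof. by move=> Pt u; rewrite -[u]upi_repr. Qed.

Definition uconst (k : K) : envel := upi (UConst k).
Definition uadd (u v : envel) := upi (UAdd (repr u) (repr v)).
Definition umul (u v : envel) := upi (UMul (repr u) (repr v)).
Definition uscale (k : K) (u : envel) := umul (uconst k) u.
Definition uopp (u : envel) := uscale (-1) u.

Lemma uaddE s t : uadd (upi s) (upi t) = upi (UAdd s t).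
Proof. by apply/upiP; apply: ueq_add; exact: ueq_repr. Qed.

Lemma umulE s t : umul (upi s) (upi t) = upi (UMul s t).
Proof. by apply/upiP; apply: ueq_mul; exact: ueq_repr. Qed.

Let uE := (uaddE, umulE).

Fact uaddA : associative uadd.
Proof.
elim/envelP=> s; elim/envelP=> t; elim/envelP=> r.
by rewrite !uE; apply/upiP; exact: ueq_addA.
Qed.

Fact uaddC : commutative uadd.
Proof.
elim/envelP=> s; elim/envelP=> t.
by rewrite !uE; apply/upiP; exact: ueq_addC.
Qed.

Fact uadd0 : left_id (uconst 0) uadd.
Proof. by elim/envelP=> t; rewrite !uE; apply/upiP; exact: ueq_add0. Qed.

Fact uaddN : left_inverse (uconst 0) uopp uadd.
Proof.
by elim/envelP=> t; rewrite /uopp /uscale umulE uaddE; apply/upiP; exact: ueq_addN.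
Qed.

HB.instance Definition _ := GRing.isZmodule.Build envel uaddA uaddC uadd0 uaddN.

Fact umulA : associative umul.
Proof.
elim/envelP=> s; elim/envelP=> t; elim/envelP=> r.
by rewrite !uE; apply/upiP; exact: ueq_mulA.
Qed.

Fact umul1 : left_id (uconst 1) umul.
Proof. by elim/envelP=> t; rewrite !uE; apply/upiP; exact: ueq_mul1. Qed.

Fact uconstC k u : umul (uconst k) u = umul u (uconst k).
Proof.
by elim/envelP: u => t; rewrite !uE; apply/upiP; exact: ueq_constC.
Qed.

Fact umul1r : right_id (uconst 1) umul.
Proof. by move=> u; rewrite -uconstC umul1. Qed.

Fact umulDl : left_distributive umul uadd.
Proof.
elim/envelP=> s; elim/envelP=> t; elim/envelP=> r.
by rewrite !uE; apply/upiP; exact: ueq_mulDl.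
Qed.

Fact umulDr : right_distributive umul uadd.
Proof.
elim/envelP=> s; elim/envelP=> t; elim/envelP=> r.
by rewrite !uE; apply/upiP; exact: ueq_mulDr.
Qed.

Section Eval.
Variables (A : algType K) (f : L -> A).

Fixpoint ueval (t : uterm) : A :=
  match t with
  | UConst k => k%:A
  | UGen x => f x
  | UAdd s t => ueval s + ueval t
  | UMul s t => ueval s * ueval t
  end.

Lemma ueval_ueq : linear f ->
  (forall x y, f (bracket x y) = f x * f y - f y * f x) ->
  forall s t, ueq s t -> ueval s = ueval t.
Proof.
move=> fP fB s t; elim=> //=.
- by move=> {}s {}t r _ -> _ ->.
- by move=> {}s s' {}t t' _ -> _ ->.
- by move=> {}s s' {}t t' _ -> _ ->.
- by move=> *; rewrite addrA.
- by move=> *; rewrite addrC.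
- by move=> *; rewrite scale0r add0r.
- by move=> *; rewrite scaleN1r mulN1r addNr scale0r.
- by move=> *; rewrite mulrA.
- by move=> *; rewrite scale1r mul1r.
- by move=> *; rewrite mulrDl.
- by move=> *; rewrite mulrDr.
- by move=> *; rewrite scalerDl.
- by move=> *; rewrite mulr_algl scalerA.
- by move=> *; rewrite mulr_algl mulr_algr.
- by move=> *; rewrite fP mulr_algl.
- by move=> x y; rewrite fB addrC subrK.
Qed.

End Eval.

Fact uconst1_neq0 : uconst 1 != uconst 0.
Proof.
apply/eqP => /upiP /(@ueval_ueq K^o (fun=> 0)) H.
have /eqP : (1%:A : K^o) = 0%:A.
  apply: H => [a x y|x y]; first by rewrite scaler0 addr0.
  by rewrite mulr0 subr0.
by rewrite scale1r scale0r oner_eq0.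
Qed.

HB.instance Definition _ := GRing.Zmodule_isNzRing.Build envel
  umulA umul1 umul1r umulDl umulDr uconst1_neq0.

Fact uscaleA a b u : uscale a (uscale b u) = uscale (a * b) u.
Proof.
rewrite /uscale umulA; congr (umul _ _).
by rewrite !uE; apply/upiP; exact/ueq_sym/ueq_constM.
Qed.

Fact uscaleDl u : {morph uscale^~ u : a b / a + b}.
Proof.
move=> a b; rewrite /uscale -[RHS]umulDl; congr (umul _ _).
by rewrite !uE; apply/upiP; exact: ueq_constD.
Qed.

HB.instance Definition _ := GRing.Zmodule_isLmodule.Build K envel
  uscaleA umul1 (fun a => umulDr (uconst a)) uscaleDl.

Fact uscaleAl a (u v : envel) : a *: (u * v) = (a *: u) * v.
Proof. exact: umulA. Qed.

HB.instance Definition _ := GRing.Lmodule_isLalgebra.Build K envel uscaleAl.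

Fact uscaleAr a (u v : envel) : a *: (u * v) = u * (a *: v).
Proof.
rewrite -[LHS]/(umul _ (umul _ _)) -[RHS]/(umul _ (umul _ _)).
by rewrite !umulA uconstC.
Qed.

HB.instance Definition _ := GRing.Lalgebra_isAlgebra.Build K envel uscaleAr.

Definition ugen (x : L) : envel := upi (UGen x).

Fact ugen_linear : linear ugen.
Proof.
move=> a x y; rewrite -[RHS]/(uadd (umul _ _) _) umulE uaddE; apply/upiP.
exact: ueq_genP.
Qed.

HB.instance Definition _ := GRing.isLinear.Build K L envel *:%R ugen ugen_linear.

Fact ugen_lie x y : ugen (bracket x y) = ugen x * ugen y - ugen y * ugen x.
Proof.
apply/eqP; rewrite eq_sym subr_eq addrC; apply/eqP.
rewrite -[LHS]/(umul _ _) -[RHS]/(uadd (umul _ _) _) !umulE uaddE; apply/upiP.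
exact: ueq_genB.
Qed.

HB.instance Definition _ := isLieMorphism.Build K L envel ugen ugen_lie.

End EnvelopingAlgebra.

Arguments ugen {K L}.

(* The algebra morphism from the enveloping algebra extending [f]. *)
Section Lift.
Variables (K : fieldType) (L : lieAlgType K) (A : algType K).
Variable f : {liemorphism L -> A}.

Definition ulift (u : envel L) : A := ueval f (repr u).

Lemma uliftE t : ulift (upi t) = ueval f t.
Proof. exact/(ueval_ueq (@linearP _ _ _ _ f) lie_morph)/ueq_repr. Qed.

Lemma ulift_gen x : ulift (ugen x) = f x.
Proof. exact: uliftE. Qed.

Fact ulift_linear : linear ulift.
Proof.
move=> a; elim/envelP=> s; elim/envelP=> t.
rewrite -[_ + _]/(uadd (umul _ _) _) umulE uaddE !uliftE /=.
by rewrite mulr_algl.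
Qed.

Fact ulift_monoid : monoid_morphism ulift.
Proof.
split; first by rewrite -[1]/(uconst L 1) uliftE /= scale1r.
elim/envelP=> s; elim/envelP=> t.
by rewrite -[_ * _ in LHS]/(umul _ _) umulE !uliftE.
Qed.

HB.instance Definition _ :=
  GRing.isLinear.Build K (envel L) A *:%R ulift ulift_linear.
HB.instance Definition _ :=
  GRing.isMonoidMorphism.Build (envel L) A ulift ulift_monoid.

End Lift.

Section ConverseAlgebra.
Variables (K : fieldType) (A : algType K).

HB.instance Definition _ := GRing.Lmodule.on A^c.

Fact converse_scalerAl (a : K) (u v : A^c) :
  a *: (u * v : A^c) = (a *: u : A^c) * v.
Proof. exact: (@GRing.scalerAr K A a v u). Qed.

HB.instance Definition _ :=
  GRing.Lmodule_isLalgebra.Build K A^c converse_scalerAl.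

Fact converse_scalerAr (a : K) (u v : A^c) :
  a *: (u * v : A^c) = u * (a *: v : A^c).
Proof. exact: (@GRing.scalerAl K A a v u). Qed.

HB.instance Definition _ :=
  GRing.Lalgebra_isAlgebra.Build K A^c converse_scalerAr.

Lemma converse_commutator (u v : A^c) :
  u * v - v * u = (v : A) * (u : A) - (u : A) * (v : A).
Proof. by []. Qed.

End ConverseAlgebra.

(* The tensor product of [B], a right [A]-module via [i], with the left
   [A]-module [N], as a left [B]-module. *)

Section Induced.
Variables (A B : pzRingType) (i : {rmorphism A -> B}) (N : lmodType A).

Inductive iterm : Type :=
  | ITens of B & N
  | IZero
  | IOpp of iterm
  | IAdd of iterm & iterm.

(* The least congruence making [iterm] an abelian group in which [ITens] is
   biadditive and [A]-balanced. *)
Inductive ieq : iterm -> iterm -> Prop :=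
  | ieq_refl t : ieq t t
  | ieq_sym s t : ieq s t -> ieq t s
  | ieq_trans s t r : ieq s t -> ieq t r -> ieq s r
  | ieq_opp s s' : ieq s s' -> ieq (IOpp s) (IOpp s')
  | ieq_add s s' t t' : ieq s s' -> ieq t t' -> ieq (IAdd s t) (IAdd s' t')
  | ieq_addA s t r : ieq (IAdd s (IAdd t r)) (IAdd (IAdd s t) r)
  | ieq_addC s t : ieq (IAdd s t) (IAdd t s)
  | ieq_add0 t : ieq (IAdd IZero t) t
  | ieq_addN t : ieq (IAdd (IOpp t) t) IZero
  | ieq_tensDl b b' n : ieq (ITens (b + b') n) (IAdd (ITens b n) (ITens b' n))
  | ieq_tensDr b n n' : ieq (ITens b (n + n')) (IAdd (ITens b n) (ITens b n'))
  | ieq_tensA b a n : ieq (ITens (b * i a) n) (ITens b (a *: n)).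

HB.instance Definition _ := gen_eqMixin iterm.
HB.instance Definition _ := gen_choiceMixin iterm.

Definition ieqb : rel iterm := fun s t => `[< ieq s t >].

Lemma ieqb_refl : reflexive ieqb.
Proof. by move=> t; apply/asboolP; exact: ieq_refl. Qed.

Lemma ieqb_sym : symmetric ieqb.
Proof. by move=> s t; apply/asboolP/asboolP; exact: ieq_sym. Qed.

Lemma ieqb_trans : transitive ieqb.
Proof.
by move=> s t r /asboolP ts /asboolP sr; apply/asboolP; exact: ieq_trans sr.
Qed.

Canonical ieqb_equiv := EquivRel ieqb ieqb_refl ieqb_sym ieqb_trans.

Definition induced : Type := {eq_quot ieqb}.

HB.instance Definition _ := Choice.on induced.
HB.instance Definition _ := Quotient.on induced.

Definition ipi (t : iterm) : induced := \pi_induced t.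

Lemma ipiP s t : ipi s = ipi t <-> ieq s t.
Proof.
by split=> [/(@eqmodP _ ieqb_equiv) /asboolP //|st]; apply/eqmodP/asboolP.
Qed.

Lemma ipi_repr u : ipi (repr u) = u.
Proof. exact: reprK. Qed.

Lemma ieq_repr t : ieq (repr (ipi t)) t.
Proof. by apply/ipiP; rewrite ipi_repr. Qed.

Lemma inducedP (P : induced -> Prop) : (forall t, P (ipi t)) -> forall u, P u.
Proof. by move=> Pt u; rewrite -[u]ipi_repr. Qed.

Definition iadd (u v : induced) := ipi (IAdd (repr u) (repr v)).
Definition iopp (u : induced) := ipi (IOpp (repr u)).

Lemma iaddE s t : iadd (ipi s) (ipi t) = ipi (IAdd s t).
Proof. by apply/ipiP; apply: ieq_add; exact: ieq_repr. Qed.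

Lemma ioppE s : iopp (ipi s) = ipi (IOpp s).
Proof. by apply/ipiP; apply: ieq_opp; exact: ieq_repr. Qed.

Let iE := (iaddE, ioppE).

Fact iaddA : associative iadd.
Proof.
elim/inducedP=> s; elim/inducedP=> t; elim/inducedP=> r.
by rewrite !iE; apply/ipiP; exact: ieq_addA.
Qed.

Fact iaddC : commutative iadd.
Proof.
elim/inducedP=> s; elim/inducedP=> t.
by rewrite !iE; apply/ipiP; exact: ieq_addC.
Qed.

Fact iadd0 : left_id (ipi IZero) iadd.
Proof. by elim/inducedP=> t; rewrite !iE; apply/ipiP; exact: ieq_add0. Qed.

Fact iaddN : left_inverse (ipi IZero) iopp iadd.
Proof. by elim/inducedP=> t; rewrite !iE; apply/ipiP; exact: ieq_addN. Qed.

HB.instance Definition _ :=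
  GRing.isZmodule.Build induced iaddA iaddC iadd0 iaddN.

Definition tens (b : B) (n : N) : induced := ipi (ITens b n).

Fixpoint iact_term (b : B) (t : iterm) : iterm :=
  match t with
  | ITens b' n => ITens (b * b') n
  | IZero => IZero
  | IOpp t => IOpp (iact_term b t)
  | IAdd s t => IAdd (iact_term b s) (iact_term b t)
  end.

Lemma iact_term_ieq b s t : ieq s t -> ieq (iact_term b s) (iact_term b t).
Proof.
elim=> /=; try by (move=> *; constructor).
- by move=> {}s {}t r _ st _; exact: ieq_trans.
- by move=> *; rewrite mulrDr; constructor.
- by move=> *; rewrite mulrA; constructor.
Qed.

Definition iact (b : B) (u : induced) : induced := ipi (iact_term b (repr u)).

Lemma iactE b t : iact b (ipi t) = ipi (iact_term b t).
Proof. by apply/ipiP; apply: iact_term_ieq; exact: ieq_repr. Qed.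

Lemma ipiD s t : ipi (IAdd s t) = ipi s + ipi t.
Proof. by rewrite -[RHS]/(iadd _ _) iaddE. Qed.

Lemma ipiN s : ipi (IOpp s) = - ipi s.
Proof. by rewrite -[RHS]/(iopp _) ioppE. Qed.

Fact iactA a b u : iact a (iact b u) = iact (a * b) u.
Proof.
elim/inducedP: u => t; rewrite !iactE.
by elim: t => //= [c n|t IH|s IHs t IHt]; rewrite ?ipiN ?ipiD ?mulrA ?IH ?IHs ?IHt.
Qed.

Fact iact1 : left_id 1 iact.
Proof.
elim/inducedP=> t; rewrite !iactE.
by elim: t => //= [c n|t IH|s IHs t IHt]; rewrite ?ipiN ?ipiD ?mul1r ?IH ?IHs ?IHt.
Qed.

Fact iactDr : right_distributive iact +%R.
Proof.
move=> a; elim/inducedP=> s; elim/inducedP=> t.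
by rewrite -ipiD !iactE -ipiD.
Qed.

Fact iactDl u : {morph iact^~ u : a b / a + b}.
Proof.
move=> a b; elim/inducedP: u => t; rewrite !iactE.
elim: t => /= [c n||t IH|s IHs t IHt].
- by rewrite mulrDl -ipiD; apply/ipiP; constructor.
- by rewrite -ipiD; apply/ipiP/ieq_sym; constructor.
- by rewrite !ipiN IH opprD.
- by rewrite !ipiD IHs IHt addrACA.
Qed.

HB.instance Definition _ :=
  GRing.Zmodule_isLmodule.Build B induced iactA iact1 iactDr iactDl.

End Induced.

Section Restriction.
Variables (K : fieldType) (A : algType K) (M : lmodType A).

Definition restrict_scalars : Type := M.

HB.instance Definition _ := GRing.Zmodule.on restrict_scalars.

Definition kscale (k : K) (m : restrict_scalars) : restrict_scalars :=
  (k%:A : A) *: (m : M).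

Fact kscaleA a b m : kscale a (kscale b m) = kscale (a * b) m.
Proof. by rewrite /kscale scalerA mulr_algl scalerA. Qed.

Fact kscale1 : left_id 1 kscale.
Proof. by move=> m; rewrite /kscale !scale1r. Qed.

Fact kscaleDr : right_distributive kscale +%R.
Proof. by move=> a m m'; exact: scalerDr. Qed.

Fact kscaleDl m : {morph kscale^~ m : a b / a + b}.
Proof. by move=> a b; rewrite /kscale !scalerDl. Qed.

HB.instance Definition _ := GRing.Zmodule_isLmodule.Build K restrict_scalars
  kscaleA kscale1 kscaleDr kscaleDl.

Definition act (a : A) (m : restrict_scalars) : restrict_scalars :=
  a *: (m : M).

End Restriction.

(* [la] is weakly decreasing with positive entries. *)
Definition is_partition (la : seq nat) : bool := sorted geq la && (0 \notin la)%N.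

(* A partition of n has at most n parts, each at most n. *)
Definition partn_pred (n : nat) (la : n.-bseq 'I_n.+1) : bool :=
  is_partition (map val la) && (sumn (map val la) == n).
Definition partn (n : nat) : Type := {la : n.-bseq 'I_n.+1 | partn_pred la}.
HB.instance Definition _ n := SubFinite.on (partn n).
Definition partn_seq n (p : partn n) : seq nat := map val (val p).

Lemma partn_seqP n (la : seq nat) :
  is_partition la -> sumn la = n -> exists p : partn n, partn_seq p = la.
Proof.
move=> la_part la_n.
have sz : (size la <= n)%N.
  have /andP[_] := la_part; rewrite -la_n; elim: la {la_n la_part} => //= x s IH.
  by rewrite inE negb_or eq_sym -lt0n => /andP[x0 /IH sz]; exact: (leq_add x0 sz).
have le k : k \in la -> (k < n.+1)%N.
  by rewrite ltnS -la_n; elim: la {la_part la_n sz} => //= x s IH;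
    rewrite inE => /orP[/eqP ->|/IH /leq_trans ->] //; rewrite ?leq_addr ?leq_addl.
have mapK : map val (map (@inord n) la) = la.
  by rewrite -map_comp map_id_in // => k /le /inordK.
have sz' : (size (map (@inord n) la) <= n)%N by rewrite size_map.
have pP : partn_pred (Bseq sz') by rewrite /partn_pred /= mapK la_part la_n /=.
by exists (exist _ (Bseq sz') pP); rewrite /partn_seq /= mapK.
Qed.

(* The index [Some k] stands for b_k and [None] for c; the bracket below depends
   on [w1]. *)
Definition heis (R : realType) (w1 : R) : Type := {malg R[i][option int]}.

Section Heisenberg.
Variables (R : realType) (w1 : R).
Local Notation C := R[i].
Local Notation heis := (heis w1).

HB.instance Definition _ := GRing.Lmodule.on heis.

Definition hbasis (i : option int) : heis := << i >>.
Definition hb (k : int) : heis := hbasis (Some k).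
Definition hc : heis := hbasis None.

Definition hcoef (i : option int) (x : heis) : C := mcoeff i x.
Definition hsupp (x : heis) : {fset option int} := msupp x.

Lemma hcoef_linear i : scalar (hcoef i).
Proof. by move=> a x y; rewrite /hcoef mcoeffD mcoeffZ. Qed.

Lemma hcoef_notin i x : i \notin hsupp x -> hcoef i x = 0.
Proof. exact: mcoeff_outdom. Qed.

Lemma hsupp_hbasis i : hsupp (hbasis i) = [fset i]%fset.
Proof. by rewrite /hsupp msuppU oner_eq0. Qed.

Lemma hcoef_hbasis i j : hcoef j (hbasis i) = (i == j)%:R.
Proof. exact: mcoeffU. Qed.

(* The linear map with prescribed values [h] on the basis. *)
Definition hext (V : lmodType C) (h : option int -> V) (x : heis) : V :=
  \sum_(i <- hsupp x) hcoef i x *: h i.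

Section Ext.
Variables (V : lmodType C).
Implicit Types (h : option int -> V) (x y : heis).

Lemma hextEw h (d : {fset option int}) x : (hsupp x `<=` d)%fset ->
  hext h x = \sum_(i <- d) hcoef i x *: h i.
Proof.
move=> le; rewrite [LHS](big_fset_incl _ le) => //= i _ /hcoef_notin ->.
by rewrite scale0r.
Qed.

Lemma hext_linear h : linear (hext h).
Proof.
move=> a x y; pose d := (hsupp x `|` hsupp y `|` hsupp (a *: x + y)%R)%fset.
rewrite !(@hextEw _ d) ?/d ?fsubsetUr//.
- rewrite scaler_sumr -big_split /=; apply: eq_bigr => i _.
  by rewrite hcoef_linear scalerDl scalerA.
- by rewrite -fsetUA fsetUCA fsubsetUl.
- by rewrite -fsetUA fsubsetUl.
Qed.

HB.instance Definition _ h :=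
  GRing.isLinear.Build C heis V *:%R (hext h) (hext_linear h).

Lemma hext_hbasis h i : hext h (hbasis i) = h i.
Proof. by rewrite /hext hsupp_hbasis big_seq_fset1 hcoef_hbasis eqxx scale1r. Qed.

Lemma linear_hext (W : lmodType C) (f : V -> W) h x :
  linear f -> f (hext h x) = hext (f \o h) x.
Proof.
move=> fP; rewrite /hext; elim: (hsupp x : seq _) => [|i r IH].
  by have := fP (-1) 0 0; rewrite !scaleN1r oppr0 add0r addNr !big_nil.
by rewrite !big_cons fP IH.
Qed.

Lemma hext2_linearr (h : option int -> option int -> V) x :
  linear (fun y => hext (fun i => hext (h i) y) x).
Proof.
move=> a y z; rewrite /hext scaler_sumr -big_split; apply: eq_bigr => i _.
by rewrite -!/(hext _ _) hext_linear scalerDr !scalerA mulrC.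
Qed.

Lemma hext2C (h : option int -> option int -> V) x y :
  hext (fun i => hext (h i) y) x = hext (fun j => hext (h^~ j) x) y.
Proof.
rewrite /hext; under eq_bigr do rewrite scaler_sumr.
rewrite exchange_big; apply: eq_bigr => j _; rewrite scaler_sumr.
by apply: eq_bigr => i _; rewrite !scalerA mulrC.
Qed.

Lemma hextN h x : hext (fun i => - h i) x = - hext h x.
Proof. by rewrite /hext -sumrN; apply: eq_bigr => i _; rewrite scalerN. Qed.

Lemma eq_hext h h' x : (forall i, i \in hsupp x -> h i = h' i) ->
  hext h x = hext h' x.
Proof. by move=> hh'; apply: eq_big_seq => i /hh' ->. Qed.

End Ext.

(* [b_k, b_l] = k delta_{k+l,0} w1 c and c is central. *)
Definition hbracket_basis (i j : option int) : heis :=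
  match i, j with
  | Some k, Some l =>
      if k + l == 0 then (k%:~R * (w1%:C)%C : C) *: hc else 0
  | _, _ => 0
  end.

Definition hbracket (x y : heis) : heis :=
  hext (fun i => hext (hbracket_basis i) y) x.

Fact hbracket_linearl y : linear (hbracket^~ y).
Proof. exact: hext_linear. Qed.

Fact hbracket_linearr x : linear (hbracket x).
Proof. exact: hext2_linearr. Qed.

Lemma hbracket_hb k l :
  hbracket (hb k) (hb l)
    = if k + l == 0 then (k%:~R * (w1%:C)%C : C) *: hc else 0.
Proof. by rewrite /hbracket !hext_hbasis. Qed.

Lemma hbracket_basisC i j : hbracket_basis i j = - hbracket_basis j i.
Proof.
case: i j => [k|] [l|] /=; rewrite ?oppr0 //.
rewrite [l + k]addrC; case: eqP => [|_]; last by rewrite oppr0.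
by move/(canRL (addrK _)); rewrite sub0r => ->; rewrite mulrNz mulNr scaleNr.
Qed.

Lemma hbracketC x y : hbracket x y = - hbracket y x.
Proof.
have -> : hbracket x y = hext (fun j => hext (hbracket_basis^~ j) x) y.
  exact: hext2C.
have H j : hext (hbracket_basis^~ j) x = - hext (hbracket_basis j) x.
  rewrite -(@hextN heis).
  by apply: eq_hext => i _; exact: hbracket_basisC.
rewrite /hbracket -(@hextN heis).
by apply: eq_hext => j _.
Qed.

Fact hbracketxx x : hbracket x x = 0.
Proof.
have H : hbracket x x + hbracket x x = 0 by rewrite {1}hbracketC addNr.
apply/malgP => i; have /(congr1 (hcoef i)) := H; rewrite /hcoef mcoeffD mcoeff0.
by rewrite -mulr2n => /eqP; rewrite mulrn_eq0 => /eqP.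
Qed.

Lemma hbracket_hc x : hbracket x hc = 0.
Proof.
rewrite /hbracket /hext big1 // => i _.
by rewrite [X in _ *: X]hext_hbasis; case: i => [?|]; rewrite /= scaler0.
Qed.

Lemma hbracket_central x y : exists t, hbracket x y = t *: hc.
Proof.
have Z (I : eqType) (r : seq I) (F : I -> heis) :
    (forall i, exists t, F i = t *: hc) -> exists t, \sum_(i <- r) F i = t *: hc.
  move=> FP; elim: r => [|i r [t IH]]; first by exists 0; rewrite big_nil scale0r.
  by have [u Fi] := FP i; exists (u + t); rewrite big_cons Fi IH scalerDl.
apply: (@Z) => i; have [t ->] : exists t, hext (hbracket_basis i) y = t *: hc.
  apply: (@Z) => j; case: i j => [k|] [l|] /=; try by exists 0; rewrite scaler0 scale0r.
  case: ifP => _; last by exists 0; rewrite scaler0 scale0r.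
  by rewrite scalerA; eexists.
by rewrite scalerA; eexists.
Qed.

Fact hjacobi x y z :
  hbracket x (hbracket y z) + hbracket y (hbracket z x)
    + hbracket z (hbracket x y) = 0.
Proof.
have Z u v w : hbracket u (hbracket v w) = 0.
  have [t ->] := hbracket_central v w.
  rewrite (GRing.scalable_linear (hbracket_linearr u)) hbracket_hc.
  exact: scaler0.
by rewrite !Z !addr0.
Qed.

HB.instance Definition _ := isLieAlgebra.Build C heis
  hbracket_linearl hbracket_linearr hbracketxx hjacobi.

(* The linear span of the basis vectors with index in [P]. *)
Definition hspan (P : pred (option int)) : {pred heis} :=
  fun x => all P (hsupp x).

Lemma hspanP (P : pred (option int)) x :
  reflect (forall i, i \in hsupp x -> P i) (x \in hspan P).
Proof. exact: allP. Qed.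

Fact hspan_submod P : submod_closed (hspan P).
Proof.
split=> [|a x y /hspanP Px /hspanP Py]; apply/hspanP => i.
  by rewrite /hsupp msupp0.
rewrite /hsupp -mcoeff_neq0 -/(hcoef i _) hcoef_linear.
have [/Px //|/hcoef_notin ->] := boolP (i \in hsupp x).
have [/Py //|/hcoef_notin ->] := boolP (i \in hsupp y).
by rewrite mulr0 addr0 eqxx.
Qed.

HB.instance Definition _ P :=
  GRing.isSubmodClosed.Build C heis (hspan P) (hspan_submod P).

Definition hsub (P : pred (option int)) : Type := {x : heis | x \in hspan P}.

HB.instance Definition _ P := SubChoice.on (hsub P).
HB.instance Definition _ P :=
  [SubChoice_isSubLmodule of hsub P by <:].

(* H_0 = C b_0 + C c *)
Definition cartan : Type := hsub (pred2 (Some 0) None).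

(* H_+ + H_0 *)
Definition borel_index (i : option int) : bool :=
  if i is Some k then 0 <= k else true.
Definition borel : Type := hsub borel_index.

HB.instance Definition _ := SubChoice.on cartan.
HB.instance Definition _ := GRing.Lmodule.on cartan.
HB.instance Definition _ := SubChoice.on borel.
HB.instance Definition _ := GRing.Lmodule.on borel.

Lemma hbasis_hspan (P : pred (option int)) i : P i -> hbasis i \in hspan P.
Proof. by move=> Pi; apply/hspanP => j; rewrite hsupp_hbasis inE => /eqP ->. Qed.

Definition cartan_b0 : cartan :=
  exist _ (hb 0) (@hbasis_hspan (pred2 (Some 0) None) (Some 0) isT).
Definition cartan_c : cartan :=
  exist _ hc (@hbasis_hspan (pred2 (Some 0) None) None isT).

Definition borel_val (x : borel) : heis := \val x.

Fact borel_val_linear : linear borel_val.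
Proof. by []. Qed.

HB.instance Definition _ :=
  GRing.isLinear.Build C borel heis *:%R borel_val borel_val_linear.

Fact borel_bracket_subproof (x y : borel) :
  hbracket (borel_val x) (borel_val y) \in hspan borel_index.
Proof.
have [t ->] := hbracket_central (borel_val x) (borel_val y).
exact/rpredZ/hbasis_hspan.
Qed.

Definition borel_bracket (x y : borel) : borel :=
  exist _ (hbracket (borel_val x) (borel_val y)) (borel_bracket_subproof x y).

Fact borel_bracket_linearl y : linear (borel_bracket^~ y).
Proof. by move=> a x z; apply/val_inj/hbracket_linearl. Qed.

Fact borel_bracket_linearr x : linear (borel_bracket x).
Proof. by move=> a y z; apply/val_inj/hbracket_linearr. Qed.

Fact borel_bracketxx x : borel_bracket x x = 0.
Proof. exact/val_inj/hbracketxx. Qed.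

Fact borel_jacobi x y z :
  borel_bracket x (borel_bracket y z) + borel_bracket y (borel_bracket z x)
    + borel_bracket z (borel_bracket x y) = 0.
Proof. exact/val_inj/hjacobi. Qed.

HB.instance Definition _ := isLieAlgebra.Build C borel
  borel_bracket_linearl borel_bracket_linearr borel_bracketxx borel_jacobi.

Lemma borel_abelian (x y : borel) : bracket x y = 0.
Proof.
apply: val_inj; rewrite /= /hbracket /hext big1_seq // => i /andP[_ ix].
rewrite big1_seq ?scaler0 // => j /andP[_ jy].
have /hspanP /(_ i ix) := valP x; have /hspanP /(_ j jy) := valP y.
case: i j {ix jy} => [k|] [l|] //=; rewrite ?scaler0 // => l0 k0.
case: eqP => [kl|_]; last by rewrite scaler0.
have -> : k = 0 by apply/eqP; rewrite eq_le k0 -kl lerDl l0.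
by rewrite mul0r scale0r scaler0.
Qed.

(* The inclusion U(H_+ + H_0) -> U(H). *)
Definition borel_ugen (x : borel) : envel heis := ugen (borel_val x).

Fact borel_ugen_linear : linear borel_ugen.
Proof. by move=> a x y; rewrite /borel_ugen !linearP. Qed.

HB.instance Definition _ := GRing.isLinear.Build C borel (envel heis) *:%R
  borel_ugen borel_ugen_linear.

Fact borel_ugen_lie x y :
  borel_ugen (bracket x y)
    = borel_ugen x * borel_ugen y - borel_ugen y * borel_ugen x.
Proof. exact: (ugen_lie (borel_val x) (borel_val y)). Qed.

HB.instance Definition _ := isLieMorphism.Build C borel (envel heis)
  borel_ugen borel_ugen_lie.

Definition borel_incl : envel borel -> envel heis := ulift borel_ugen.

HB.instance Definition _ := GRing.RMorphism.on borel_incl.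

Definition hopp_basis (i : option int) : heis := hbasis (omap -%R i).

Lemma hext_hopp_bracket (x y : heis) :
  hext hopp_basis (bracket x y)
    = bracket (hext hopp_basis y) (hext hopp_basis x).
Proof.
have B i j : hext hopp_basis (hbracket_basis i j)
               = hbracket (hopp_basis j) (hopp_basis i).
  rewrite /hbracket !hext_hbasis.
  case: i j => [k|] [l|]; rewrite /= ?linear0 // -opprD oppr_eq0.
  rewrite [l + k]addrC; case: eqP => [kl|_]; last by rewrite linear0.
  by rewrite linearZ /= hext_hbasis -(addr0_eq kl) opprK.
rewrite -[RHS]/(hbracket _ _) (linear_hext _ _ (hbracket_linearl _)).
rewrite (linear_hext _ _ (hext_linear _)).
have E := hext2C (fun i j => hext hopp_basis (hbracket_basis i j)) x y.
apply: etrans (etrans E _).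
  apply: eq_hext => i _; exact: (linear_hext _ _ (hext_linear _)).
apply: eq_hext => j _; rewrite [RHS]/= (linear_hext _ _ (hbracket_linearr _)).
by apply: eq_hext => i _; exact: B.
Qed.

(* b_k |-> b_{-k}, c |-> c; its lift [uomega] to U(H) is an anti-morphism since
   the target is the converse algebra. *)
Definition homega (x : heis) : (envel heis)^c := ugen (hext hopp_basis x).

Fact homega_linear : linear homega.
Proof.
move=> a x y; rewrite /homega (hext_linear hopp_basis).
exact: ugen_linear.
Qed.

HB.instance Definition _ := GRing.isLinear.Build C heis (envel heis)^c *:%R
  homega homega_linear.

Fact homega_lie (x y : heis) :
  homega (bracket x y) = homega x * homega y - homega y * homega x.
Proof.
rewrite /homega hext_hopp_bracket.
apply: etrans (ugen_lie _ _) _; exact/esym/converse_commutator.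
Qed.

HB.instance Definition _ := isLieMorphism.Build C heis (envel heis)^c
  homega homega_lie.

Definition uomega (u : envel heis) : envel heis := ulift homega u.

Lemma uomega1 : uomega 1 = 1.
Proof. exact: (rmorph1 (ulift homega)). Qed.

Lemma uomega_linear : linear uomega.
Proof. exact: (ulift_linear homega). Qed.

Lemma uomegaM u v : uomega (u * v) = uomega v * uomega u.
Proof. exact: (rmorphM (ulift homega)). Qed.

Lemma uomega_hb k : uomega (ugen (hb k)) = ugen (hb (- k)).
Proof. by rewrite /uomega ulift_gen /= /homega hext_hbasis. Qed.

Lemma uomega_hc : uomega (ugen hc) = ugen hc.
Proof. by rewrite /uomega ulift_gen /= /homega hext_hbasis. Qed.

Definition Cphi (phi : {scalar cartan}) : Type := C^o.

Section Verma.
Variable phi : {scalar cartan}.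
Local Notation Cphi := (Cphi phi).

(* The action of H_+ + H_0 on C_phi: b_k acts by 0 for k > 0, while b_0 and c
   act by phi(b_0) and phi(c). *)
Definition chi_basis (i : option int) : C^o :=
  match i with
  | Some k => if k == 0 then phi cartan_b0 else 0
  | None => phi cartan_c
  end.

Definition chi (x : borel) : C^o := hext chi_basis (borel_val x).

Fact chi_linear : linear chi.
Proof. by move=> a x y; rewrite /chi !linearP. Qed.

HB.instance Definition _ :=
  GRing.isLinear.Build C borel C^o *:%R chi chi_linear.

Fact chi_lie x y : chi (bracket x y) = chi x * chi y - chi y * chi x.
Proof. by rewrite borel_abelian linear0 mulrC subrr. Qed.

HB.instance Definition _ := isLieMorphism.Build C borel C^o chi chi_lie.

HB.instance Definition _ := GRing.Zmodule.on Cphi.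

Definition Cphi_scale (u : envel borel) (z : Cphi) : Cphi :=
  (ulift chi u : C^o) * (z : C^o).

Fact Cphi_scaleA u v z : Cphi_scale u (Cphi_scale v z) = Cphi_scale (u * v) z.
Proof. by rewrite /Cphi_scale rmorphM mulrA. Qed.

Fact Cphi_scale1 : left_id 1 Cphi_scale.
Proof. by move=> z; rewrite /Cphi_scale rmorph1 mul1r. Qed.

Fact Cphi_scaleDr : right_distributive Cphi_scale +%R.
Proof. by move=> u y z; rewrite /Cphi_scale mulrDr. Qed.

Fact Cphi_scaleDl z : {morph Cphi_scale^~ z : u v / u + v}.
Proof. by move=> u v; rewrite /Cphi_scale rmorphD mulrDl. Qed.

HB.instance Definition _ := GRing.Zmodule_isLmodule.Build (envel borel) Cphi
  Cphi_scaleA Cphi_scale1 Cphi_scaleDr Cphi_scaleDl.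

Definition verma : Type := restrict_scalars (induced borel_incl Cphi).

HB.instance Definition _ := GRing.Lmodule.on verma.

Definition vphi : verma := tens borel_incl 1 ((1 : C^o) : Cphi).

Definition uact (u : envel heis) (v : verma) : verma := act u v.

(* b_{-la_1} ... b_{-la_s} v_phi *)
Definition pbw (la : seq nat) : verma :=
  uact (\prod_(k <- la) ugen (hb (- k%:Z))) vphi.

(* The level-n weight space M(phi)[-n]. *)
Definition level (n : nat) : set verma :=
  [set v | exists a : partn n -> C, v = \sum_p a p *: pbw (partn_seq p)].

Definition is_shapovalov_form (S : verma -> verma -> C) : Prop :=
  [/\ forall v w, S v w = S w v,
      forall w, scalar (S^~ w),
      S vphi vphi = 1,
      forall u v w, S (uact u v) w = S v (uact (uomega u) w)
    & forall m n v w, m != n -> level m v -> level n w -> S v w = 0].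

Definition gram (S : verma -> verma -> C) (n : nat) : 'M[C]_#|{: partn n}| :=
  \matrix_(i, j) S (pbw (partn_seq (enum_val i))) (pbw (partn_seq (enum_val j))).

Definition shapovalov_regular : Prop :=
  exists2 S, is_shapovalov_form S & forall n, (0 < n)%N -> \det (gram S n) != 0.

Definition qphi : C := (w1%:C)%C * phi cartan_c.

(* The operator of the formal sum of b_{-k} b_k over k >= 1.  The finitely
   supported sum is 0 by convention on infinite support, which never occurs:
   b_k kills any given vector for k large. *)
Definition Lsum (v : verma) : verma :=
  \sum_(k \in [set k : nat | (0 < k)%N])
     uact (ugen (hb (- k%:Z)) * ugen (hb k%:Z)) v.

Definition L0 (v : verma) : verma := qphi^-1 *: Lsum v.

Definition Omega (v : verma) : verma := - L0 (L0 v + v).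

Definition psi_spec (psi : verma -> {poly C}) : Prop :=
  forall la, is_partition la -> psi (pbw la) = 'X^(sumn la).

End Verma.
End Heisenberg.

Arguments level {R w1} phi n.
Arguments cartan {R} w1.
Arguments borel {R} w1.

Section Legendre.
Variable F : fieldType.

(* Rodrigues' formula *)
Definition legendre (n : nat) : {poly F} :=
  ((2 ^ n * n`!)%:R)^-1 *: (('X^2 - 1) ^+ n)^`(n).

Definition Psi (p : {poly F}) : {poly F} :=
  \sum_(i < size p) p`_i *: legendre i.

Lemma PsiEw n (p : {poly F}) : (size p <= n)%N ->
  Psi p = \sum_(i < n) p`_i *: legendre i.
Proof.
move=> le; rewrite /Psi -!(big_mkord xpredT (fun i => p`_i *: legendre i)).
rewrite (big_cat_nat (leq0n _) le) /= [X in _ + X]big_nat_cond.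
rewrite [X in _ + X]big1 ?addr0 // => i /andP[/andP[pi _] _].
by rewrite nth_default ?scale0r.
Qed.

Fact Psi_linear : linear Psi.
Proof.
move=> a p q; pose n := maxn (size (a *: p + q)) (maxn (size p) (size q)).
rewrite !(@PsiEw n) /n ?leq_max ?leqnn ?orbT //.
rewrite scaler_sumr -big_split; apply: eq_bigr => i _.
by rewrite coefD coefZ scalerDl scalerA.
Qed.

HB.instance Definition _ :=
  GRing.isLinear.Build F {poly F} {poly F} *:%R Psi Psi_linear.

Lemma Psi_Xn n : Psi 'X^n = legendre n.
Proof.
rewrite /Psi size_polyXn big_ord_recr /= coefXn eqxx scale1r big1 ?add0r //.
by move=> i _; rewrite coefXn ltn_eqF ?scale0r.
Qed.

Definition legendre_op (p : {poly F}) : {poly F} :=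
  (1 - 'X^2) * p^`(2) - 2%:R *: ('X * p^`()).

Definition line (p : {poly F}) : set {poly F} := [set a *: p | a in [set: F]].

End Legendre.

(* Main.v *)
(* The commutation relations give b_{-k} b_k b_{-la} v = q k m_k(la) b_{-la} v, with
   m_k(la) the multiplicity of k in la.  Summing over k, L_0 acts on the weight
   space M(phi)[-n] as n, so Omega acts as -n(n+1), the eigenvalue of the Legendre
   operator on P_n.

   A linear map on M(phi) with prescribed values on PBW vectors exists because
   these are linearly independent; this is seen on the Fock space of
   polynomials in variables x_1, x_2, ..., on which b_{-k} acts as multiplication
   by x_k and b_k as k q d/dx_k: the vector b_{-la} v goes to the monomial x^la.
   Composing with x_k |-> zeta^k gives psi. *)

Require Import Defs.
From HB Require Import structures.
From mathcomp Require Import all_boot all_order all_algebra.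
From mathcomp Require Import boolp classical_sets fsbigop reals complex.
From mathcomp Require Import finmap multiset monalg ring.

Set Implicit Arguments.
Unset Strict Implicit.
Unset Printing Implicit Defensive.

Import Order.TTheory GRing.Theory Num.Theory.

Local Open Scope classical_set_scope.
Local Open Scope ring_scope.

(** * The Legendre equation, from Rodrigues' formula *)

(* Both sides of [(X^2 - 1) u' = 2 n X u] are differentiated [m + 1] times. *)
Lemma derivn_rodrigues (F : fieldType) (n m : nat) :
  let u : {poly F} := ('X^2 - 1) ^+ n in
  ('X^2 - 1) * u^`(m.+2)
    = (2 * n%:R - 2 * m.+1%:R) * 'X * u^`(m.+1)
      + m.+1%:R * (2 * n%:R - m%:R) * u^`(m).
Proof.
(* Derives [c = d] from a known [a = b], leaving the identity [c - d = a - b] to [ring]. *)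
have move_lhs (a b c d : {poly F}) : a = b -> c - d = a - b -> c = d.
  by move=> -> /eqP; rewrite subrr subr_eq0 => /eqP.
have dn k : (k%:R : {poly F})^`() = 0 by rewrite -polyC_natr derivC.
have dX2 : ('X^2 - 1 : {poly F})^`() = 2 * 'X.
  by rewrite derivB derivXn (dn 1%N) subr0 mulr_natl.
move=> u; elim: m => [|m IH].
  have D : ('X^2 - 1) * u^`() = (2 * n%:R) * 'X * u.
    rewrite /u deriv_exp dX2; case: n {u} => [|n]; first by rewrite !mulr0n; ring.
    by rewrite [in RHS]exprSr -mulr_natr; ring.
  move/(congr1 (@deriv F)): D.
  rewrite !derivM dX2 !dn derivX -[u^`()^`()]/(u^`(2)) -[u^`()]/(u^`(1)) derivn0.
  by move/move_lhs; apply; ring.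
move/(congr1 (@deriv F)): IH.
rewrite derivM dX2 derivD !derivM !(dn, derivB, derivM) derivX -!derivnS.
by move/move_lhs; apply; rewrite -![m.+1%:R]natr1 -[m.+2%:R]natr1 -natr1; ring.
Qed.

(** For [m = n] the coefficients in [derivn_rodrigues] become -2 and n(n+1), which is the Legendre
    equation for the n-th derivative of (X^2 - 1)^n. The normalizing constant factors out by
    linearity. *)
Lemma legendre_op_legendre (F : fieldType) (n : nat) :
  legendre_op (legendre F n) = - (n * n.+1)%:R *: legendre F n.
Proof.
have := derivn_rodrigues F n n; rewrite /legendre_op /legendre.
move: (_^-1) => c; cbv zeta; move: (_ ^+ n) => u E.
rewrite derivnZ derivZ -[u^`(n)^`(2)]/(u^`(n.+2)) -derivnS.
rewrite -!scalerAr ![_ *: (c *: _)]scalerA ![_ * c]mulrC -!scalerA.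
rewrite -scalerBr; congr (c *: _).
rewrite -[1 - _]opprB mulNr E scaleNr !scaler_nat -[_ *+ 2]mulr_natl.
by rewrite -[_ *+ (_ * _)]mulr_natl natrM -![n.+1%:R]natr1; ring.
Qed.

(** * Linear maps out of a free vector space *)

Section LinearExtension.
Variables (F : fieldType) (K : choiceType) (V : lmodType F).
Implicit Types (f : K -> V) (x : {malg F[K]}).

Definition malg_ext f x : V := \sum_(k <- msupp x) mcoeff k x *: f k.

Lemma malg_extEw f (d : {fset K}) x : (msupp x `<=` d)%fset ->
  malg_ext f x = \sum_(k <- d) mcoeff k x *: f k.
Proof.
move=> le; rewrite [LHS](big_fset_incl _ le) => //= k _ /mcoeff_outdom ->.
by rewrite scale0r.
Qed.

Fact malg_ext_linear f : linear (malg_ext f).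
Proof.
move=> a x y; pose d := (msupp (a *: x + y)%R `|` (msupp x `|` msupp y))%fset.
rewrite !(@malg_extEw _ d) /d ?fsubsetUl // 1?fsetUCA ?fsubsetUl //.
  rewrite scaler_sumr -big_split; apply: eq_bigr => k _ /=.
  by rewrite mcoeffD mcoeffZ scalerDl scalerA.
by rewrite fsetUA fsubsetUr.
Qed.

HB.instance Definition _ f :=
  GRing.isLinear.Build F {malg F[K]} V *:%R (malg_ext f) (malg_ext_linear f).

Lemma malg_extU f k : malg_ext f << k >> = f k.
Proof. by rewrite /malg_ext msuppU oner_eq0 big_seq_fset1 mcoeffUU scale1r. Qed.

Lemma malg_linear_ext (f g : {malg F[K]} -> V) : linear f -> linear g ->
  (forall k, f << k >> = g << k >>) -> f =1 g.
Proof.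
move=> fP gP fg x.
pose f' : {linear {malg F[K]} -> V} :=
  HB.pack f (GRing.isLinear.Build _ _ _ _ f fP).
pose g' : {linear {malg F[K]} -> V} :=
  HB.pack g (GRing.isLinear.Build _ _ _ _ g gP).
rewrite -[f x]/(f' x) -[g x]/(g' x) (monalgE x) !linear_sum; apply: eq_bigr => k _.
have -> : << x@_k *g k >> = x@_k *: << k >> :> {malg F[K]}.
  by apply/malgP => l; rewrite mcoeffZ !mcoeffU mulr_natr.
by rewrite !linearZ /= fg.
Qed.

End LinearExtension.

(** * Fock space with its creation and annihilation operators *)

Section FockSpace.
Variable F : fieldType.

(** The multiset [m] encodes the monomial in which x_k has exponent [m k]. *)
Definition fock := {malg F[{mset nat}%mset]}.
HB.instance Definition _ := GRing.Lmodule.on fock.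
Implicit Types (k l : nat) (m : {mset nat}%mset) (v : fock).

Fact fock_basis_subproof :
  {b : {mset nat}%mset -> fock | forall m, b m = << m >>}.
Proof. by exists (fun m => << m >>). Qed.

(* Sealed: deciding whether [<< m >>] and [<< k +` m >>] are convertible takes
   forever. *)
Definition fock_basis := sval fock_basis_subproof.

Lemma fock_basisE m : fock_basis m = << m >>.
Proof. exact: (svalP fock_basis_subproof). Qed.

Definition fock_ext (V : lmodType F) (f : {mset nat}%mset -> V) : fock -> V :=
  malg_ext f.

HB.instance Definition _ (V : lmodType F) (f : {mset nat}%mset -> V) :=
  GRing.Linear.on (fock_ext f).

Lemma fock_ext_basis (V : lmodType F) (f : {mset nat}%mset -> V) m :
  fock_ext f (fock_basis m) = f m.
Proof. rewrite fock_basisE; exact: malg_extU. Qed.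

Lemma fock_linear_ext (V : lmodType F) (f g : {linear fock -> V}) :
  (forall m, f (fock_basis m) = g (fock_basis m)) -> f =1 g.
Proof.
move=> fg; apply: malg_linear_ext; [exact: linearP..|move=> m].
by rewrite -fock_basisE; exact: fg.
Qed.

Definition creation k : fock -> fock :=
  fock_ext (fun m => fock_basis (k +` m)%mset).
(** The partial derivative in x_k. If [k] is not in [m], the coefficient [m k] is 0, so the value of
    the difference there is harmless. *)
Definition annihilation k : fock -> fock :=
  fock_ext (fun m => (m k)%:R *: fock_basis (m `\ k)%mset).
Definition mset_weight (m : {mset nat}%mset) : nat := (\sum_(i <- m) i)%N.
(** On monomials, the substitution of ['X^k] for x_k. *)
Definition fock_weight : fock -> {poly F} :=
  fock_ext (fun m => 'X^(mset_weight m)).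

HB.instance Definition _ k := GRing.Linear.on (creation k).
HB.instance Definition _ k := GRing.Linear.on (annihilation k).
HB.instance Definition _ := GRing.Linear.on fock_weight.

Lemma creation_basis k m : creation k (fock_basis m) = fock_basis (k +` m)%mset.
Proof. exact: fock_ext_basis. Qed.

Lemma annihilation_basis k m :
  annihilation k (fock_basis m) = (m k)%:R *: fock_basis (m `\ k)%mset.
Proof. exact: fock_ext_basis. Qed.

Lemma creationC k l v : creation k (creation l v) = creation l (creation k v).
Proof.
apply: (fock_linear_ext (f := creation k \o creation l)
  (g := creation l \o creation k)) => m /=.
by rewrite !creation_basis msetDCA.
Qed.

Lemma annihilationC k l v :
  annihilation k (annihilation l v) = annihilation l (annihilation k v).
Proof.
apply: (fock_linear_ext (f := annihilation k \o annihilation l)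
  (g := annihilation l \o annihilation k)) => m /=.
have [-> //|kl] := eqVneq k l.
rewrite !annihilation_basis !linearZ /= !annihilation_basis !scalerA.
(* For distinct [k] and [l], removing one leaves the multiplicity of the other unchanged. *)
rewrite !msetB1E [l == k]eq_sym (negPf kl) !subn0 mulrC -!msetBDA.
by rewrite [([mset k] `+` _)%mset]msetDC.
Qed.

(** Leibniz rule for the derivative in x_k of x_l times a polynomial. *)
Lemma annihilation_creation k l v :
  annihilation k (creation l v)
    = creation l (annihilation k v) + (k == l)%:R *: v.
Proof.
apply: (fock_linear_ext (f := annihilation k \o creation l)
  (g := creation l \o annihilation k \+ (k == l)%:R \*: idfun)) => m /=.
rewrite creation_basis !annihilation_basis linearZ /= creation_basis mset1DE.
(* If [l] occurs in [m], removing and adding it gives [m] back and the coefficients add up to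
   [m l + 1]. Otherwise [m l] is 0 and only the second summand survives. *)
have [->|kl] := eqVneq k l.
  rewrite msetDKB; have [lm|] := boolP (l \in m).
    by rewrite msetB1K // -scalerDl addrC natrD.
  by move=> /mset_eq0P ->; rewrite addn0 scale0r add0r.
rewrite scale0r addr0 add0n; congr (_ *: fock_basis _); apply/msetP => i.
rewrite !(msetB1E, mset1DE); case: (eqVneq i k) => [->|]; last by rewrite !subn0.
by rewrite (negPf kl).
Qed.

Lemma fock_weight_seq (s : seq nat) :
  fock_weight (fock_basis (seq_mset s)) = 'X^(sumn s).
Proof.
rewrite /fock_weight fock_ext_basis /mset_weight.
by rewrite (perm_big _ (perm_eq_seq_mset s)) sumnE.
Qed.

Lemma creation_seq (s : seq nat) :
  foldr creation (fock_basis mset0) s = fock_basis (seq_mset s).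
Proof.
elim: s => [|k s /= ->].
  by congr fock_basis; apply/msetP => i; rewrite mset_seqE mset0E.
rewrite creation_basis; congr fock_basis.
by apply/msetP => i; rewrite mset1DE !mset_seqE /= eq_sym.
Qed.

End FockSpace.

(** * Modules over the enveloping algebra from Lie algebra representations *)

Section EnvelopingAction.
Variables (K : fieldType) (L : lieAlgType K) (V : lmodType K).
Variable op : L -> V -> V.
Hypothesis op_linearl : forall v, linear (op^~ v).
Hypothesis op_linearr : forall x, linear (op x).
Hypothesis op_bracket : forall x y v,
  op (bracket x y) v = op x (op y v) - op y (op x v).

(** Terms act directly as functions on [V]: using [ulift] would require an algebra structure on the
    linear endomorphisms of [V]. *)
Fixpoint uterm_act (t : uterm L) (v : V) : V :=
  match t with
  | UConst k => k *: v
  | UGen x => op x v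
  | UAdd s t => uterm_act s v + uterm_act t v
  | UMul s t => uterm_act s (uterm_act t v)
  end.

Lemma uterm_act_linear t : linear (uterm_act t).
Proof.
elim: t => [k|x|s IHs t IHt|s IHs t IHt] a v w /=.
- by rewrite scalerDr !scalerA mulrC.
- exact: op_linearr.
- by rewrite IHs IHt scalerDr addrACA.
- by rewrite IHt IHs.
Qed.

HB.instance Definition _ t :=
  GRing.isLinear.Build K V V *:%R (uterm_act t) (uterm_act_linear t).

(** Each defining relation is an identity of operators. Right distributivity and the centrality of
    constants rest on linearity in the vector, the two relations on generators on [op_linearl] and
    [op_bracket]. *)
Lemma uterm_act_ueq s t : ueq s t -> uterm_act s =1 uterm_act t.
Proof.
elim=> /=.
- by [].
- by move=> {}s {}t _ st v /=; rewrite st.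
- by move=> {}s {}t r _ st _ tr v /=; rewrite st tr.
- by move=> {}s s' {}t t' _ ss' _ tt' v /=; rewrite ss' tt'.
- by move=> {}s s' {}t t' _ ss' _ tt' v /=; rewrite tt' ss'.
- by move=> * ? /=; rewrite addrA.
- by move=> * ? /=; rewrite addrC.
- by move=> * ? /=; rewrite scale0r add0r.
- by move=> * ? /=; rewrite scaleN1r addNr scale0r.
- by [].
- by move=> * ? /=; rewrite scale1r.
- by [].
- by move=> * ? /=; rewrite linearD.
- by move=> * ? /=; rewrite scalerDl.
- by move=> * ? /=; rewrite scalerA.
- by move=> * ? /=; rewrite linearZ.
- by move=> * ? /=; rewrite op_linearl.
- by move=> x y v /=; rewrite op_bracket addrC subrK.
Qed.

Definition envel_act (u : envel L) : V -> V := uterm_act (repr u).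

Lemma envel_act_upi t v : envel_act (upi t) v = uterm_act t v.
Proof. exact/uterm_act_ueq/ueq_repr. Qed.

Lemma envel_act_gen x v : envel_act (ugen x) v = op x v.
Proof. exact: envel_act_upi. Qed.

Lemma envel_actM s t v : envel_act (s * t) v = envel_act s (envel_act t v).
Proof.
elim/envelP: s => s; elim/envelP: t => t.
by rewrite -[_ * _]/(umul _ _) umulE !envel_act_upi.
Qed.

Lemma envel_actD s t v : envel_act (s + t) v = envel_act s v + envel_act t v.
Proof.
elim/envelP: s => s; elim/envelP: t => t.
by rewrite -[_ + _ in LHS]/(uadd _ _) uaddE !envel_act_upi.
Qed.

Lemma envel_act_alg k v : envel_act k%:A v = k *: v.
Proof.
rewrite -[k%:A]/(umul (upi _) (upi _)) umulE envel_act_upi /=.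
by rewrite scale1r.
Qed.

End EnvelopingAction.

(** * The universal property of the induced module *)

Section InducedLift.
Variables (A B : pzRingType) (i : {rmorphism A -> B}) (N : lmodType A).
Variables (W : zmodType) (g : B -> N -> W).
Hypothesis gDl : forall b b' n, g (b + b') n = g b n + g b' n.
Hypothesis gDr : forall b n n', g b (n + n') = g b n + g b n'.
Hypothesis gA : forall b a n, g (b * i a) n = g b (a *: n).

Fixpoint iterm_eval (t : iterm B N) : W :=
  match t with
  | ITens b n => g b n
  | Defs.IZero => 0
  | Defs.IOpp t => - iterm_eval t
  | Defs.IAdd s t => iterm_eval s + iterm_eval t
  end.

Lemma iterm_eval_ieq s t : ieq i s t -> iterm_eval s = iterm_eval t.
Proof.
elim=> //=.
- by move=> {}s {}t r _ -> _ ->.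
- by move=> {}s s' _ ->.
- by move=> {}s s' {}t t' _ -> _ ->.
- by move=> *; rewrite addrA.
- by move=> *; rewrite addrC.
- by move=> *; rewrite add0r.
- by move=> *; rewrite addNr.
Qed.

Definition induced_lift (u : induced i N) : W := iterm_eval (repr u).

Lemma induced_lift_ipi t : induced_lift (ipi i t) = iterm_eval t.
Proof. exact/iterm_eval_ieq/ieq_repr. Qed.

Lemma induced_lift_tens b n : induced_lift (tens i b n) = g b n.
Proof. exact: induced_lift_ipi. Qed.

Lemma induced_liftD u v : induced_lift (u + v) = induced_lift u + induced_lift v.
Proof.
elim/inducedP: u => s; elim/inducedP: v => t.
by rewrite -ipiD !induced_lift_ipi.
Qed.

Lemma induced_ind (P : induced i N -> Prop) :
  P 0 -> (forall u, P u -> P (- u)) -> (forall u v, P u -> P v -> P (u + v)) ->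
  (forall b n, P (tens i b n)) -> forall u, P u.
Proof.
move=> P0 PN PD PT; elim/inducedP; elim=> [b n||t IH|s IHs t IHt].
- exact: PT.
- exact: P0.
- by rewrite ipiN; exact: PN.
- by rewrite ipiD; exact: PD.
Qed.

Lemma scale_tens b b' (n : N) : b *: tens i b' n = tens i (b * b') n.
Proof. exact: iactE. Qed.

Lemma tensA b a (n : N) : tens i (b * i a) n = tens i b (a *: n).
Proof. by apply/ipiP; constructor. Qed.

End InducedLift.

(** * The Heisenberg algebra acting on Fock space *)

Section FockRepresentation.
Variables (R : realType) (w1 : R) (phi : {scalar cartan w1}).
Local Notation C := R[i].
Local Notation heis := (heis w1).
Local Notation fock := (fock C).
Local Notation q := (qphi phi).
Implicit Types (v : fock) (x y : heis).

(** [Negz n] is -(n+1), hence a creation operator. The factor k q on the derivative makes the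
    commutator of b_k and b_{-k} the scalar k q, as required when [c] acts by phi(c). *)
Definition fock_op (i : option int) : fock -> fock :=
  match i with
  | Some (Negz n) => creation n.+1
  | Some (Posz 0) => *:%R (phi (cartan_b0 w1))
  | Some (Posz k) => (k%:R * q) \*: annihilation k
  | None => *:%R (phi (cartan_c w1))
  end.

Lemma fock_op_linear i : linear (fock_op i).
Proof.
have scale_linear (a : C) : linear ( *:%R a : fock -> fock).
  by move=> b v w; rewrite scalerDr !scalerA mulrC.
case: i => [[[|k]|n]|]; try exact: scale_linear.
  move=> a v w; rewrite [LHS]/= (linearP (annihilation k.+1)) scalerDr.
  by rewrite !scalerA mulrC.
exact: (linearP (creation n.+1)).
Qed.

HB.instance Definition _ i :=
  GRing.isLinear.Build C fock fock *:%R (fock_op i) (fock_op_linear i).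

Definition fock_act (x : heis) v : fock := hext (fock_op^~ v) x.

Fact fock_act_linearl v : linear (fock_act^~ v).
Proof. exact: hext_linear. Qed.

Fact fock_act_linearr x : linear (fock_act x).
Proof.
move=> a v w; rewrite /fock_act /hext scaler_sumr -big_split.
by apply: eq_bigr => i _; rewrite fock_op_linear scalerDr !scalerA [a * _]mulrC.
Qed.

(** The indices [Some 0] and [None] act by scalars, and operators of equal sign commute. Only
    opposite signs contribute, through the Leibniz rule. *)
Lemma fock_op_bracket i j v :
  fock_op i (fock_op j v)
    = fock_op j (fock_op i v) + fock_act (hbracket_basis w1 i j) v.
Proof.
have act0 : fock_act 0 v = 0 by rewrite /fock_act linear0.
have act_hc a : fock_act (a *: hc w1) v = a *: (phi (cartan_c w1) *: v).
  by rewrite (GRing.scalable_linear (fock_act_linearl v)) /fock_act /hc hext_hbasis.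
have pos_neg k l : fock_op (Some (Posz k.+1)) (fock_op (Some (Negz l)) v)
    = fock_op (Some (Negz l)) (fock_op (Some (Posz k.+1)) v)
      + fock_act (hbracket_basis w1 (Some (Posz k.+1)) (Some (Negz l))) v.
  have -> : hbracket_basis w1 (Some (Posz k.+1)) (Some (Negz l))
      = if k == l then (k.+1%:R * (w1%:C)%C : C) *: hc w1 else 0.
    by rewrite /hbracket_basis NegzE subr_eq0 eqz_nat.
  rewrite /= annihilation_creation scalerDr [in RHS]linearZ; congr (_ + _).
  rewrite ?eqSS; case: (k == l) => /=; last by rewrite scale0r scaler0 act0.
  by rewrite act_hc scale1r [RHS]scalerA -mulrA.
pose scalar_op i0 a := fock_op i0 =1 *:%R a.
have cartanl a : scalar_op i a -> hbracket_basis w1 i j = 0 ->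
    fock_op i (fock_op j v)
      = fock_op j (fock_op i v) + fock_act (hbracket_basis w1 i j) v.
  move=> ia ->; rewrite !ia act0 addr0.
  by rewrite (GRing.scalable_linear (fock_op_linear j)).
have cartanr a : scalar_op j a -> hbracket_basis w1 i j = 0 ->
    fock_op i (fock_op j v)
      = fock_op j (fock_op i v) + fock_act (hbracket_basis w1 i j) v.
  move=> ja ->; rewrite !ja act0 addr0.
  by rewrite (GRing.scalable_linear (fock_op_linear i)).
(* For b_0 against b_0 the delta is 1, but the factor k is 0. *)
have hb0 i' : hbracket_basis w1 (Some 0) i' = 0.
  by case: i' => [l|] //=; rewrite mul0r scale0r if_same.
case: i cartanl cartanr => [k|] cartanl cartanr;
  last exact: (cartanl (phi (cartan_c w1)) (fun=> erefl) erefl).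
case: j cartanl cartanr => [l|] cartanl cartanr;
  last exact: (cartanr (phi (cartan_c w1)) (fun=> erefl) erefl).
have [k0|k0] := eqVneq k 0.
  rewrite k0 in cartanl *.
  exact: (cartanl (phi (cartan_b0 w1)) (fun=> erefl) (hb0 _)).
have [l0|l0] := eqVneq l 0.
  rewrite l0 in cartanr *.
  apply: (cartanr (phi (cartan_b0 w1)) (fun=> erefl)).
  by rewrite hbracket_basisC hb0 oppr0.
case: k l k0 l0 {cartanl cartanr} => [[|k]|k] [[|l]|l];
  do ?[by move/eqP|by move=> _ /eqP|exact: pos_neg] => _ _.
- rewrite [hbracket_basis _ _ _]/= act0 addr0 /= !linearZ /= annihilationC.
  by rewrite !scalerA mulrC.
(* The negative-positive case is [pos_neg] with the roles exchanged, by antisymmetry of the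
   bracket. *)
- rewrite hbracket_basisC; have := pos_neg l k.
  set z := hbracket_basis _ _ _; rewrite [fock_act (- _) v]/fock_act linearN.
  by rewrite -/(fock_act z v) => ->; rewrite addrK.
- by rewrite [hbracket_basis _ _ _]/= act0 addr0 /= creationC.
Qed.

Fact fock_act_bracket x y v :
  fock_act (bracket x y) v
    = fock_act x (fock_act y v) - fock_act y (fock_act x v).
Proof.
apply/eqP; rewrite eq_sym subr_eq addrC; apply/eqP.
have E x' y' : fock_act x' (fock_act y' v)
    = hext (fun i => hext (fun j => fock_op i (fock_op j v)) y') x'.
  apply: eq_hext => i _; exact: (linear_hext _ _ (fock_op_linear i)).
(* Exchanging the order of summation puts both products over the same pairs of basis indices, so
   that the basis case applies termwise. *)
rewrite !E [X in _ = X + _](hext2C (fun i j => fock_op i (fock_op j v))).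
rewrite [fock_act _ v](linear_hext _ _ (fock_act_linearl v)).
rewrite /hext -big_split /=; apply: eq_bigr => i _.
rewrite -scalerDr; congr (_ *: _).
rewrite [fock_act _ v](linear_hext _ _ (fock_act_linearl v)).
rewrite /hext -big_split /=; apply: eq_bigr => j _.
by rewrite -scalerDr fock_op_bracket.
Qed.

Definition fock_envel : envel heis -> fock -> fock := envel_act fock_act.

Lemma fock_envel_linear u : linear (fock_envel u).
Proof. exact/uterm_act_linear/fock_act_linearr. Qed.

HB.instance Definition _ u :=
  GRing.isLinear.Build C fock fock *:%R (fock_envel u) (fock_envel_linear u).

Let fock_actP := conj fock_act_linearl (conj fock_act_linearr fock_act_bracket).

Lemma fock_envel_gen x v : fock_envel (ugen x) v = fock_act x v.
Proof. by apply: envel_act_gen; case: fock_actP => ? []. Qed.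

Lemma fock_envelM s t v : fock_envel (s * t) v = fock_envel s (fock_envel t v).
Proof. by apply: envel_actM; case: fock_actP => ? []. Qed.

Lemma fock_envelD s t v : fock_envel (s + t) v = fock_envel s v + fock_envel t v.
Proof. by apply: envel_actD; case: fock_actP => ? []. Qed.

Lemma fock_envel_alg k v : fock_envel k%:A v = k *: v.
Proof. by apply: envel_act_alg; case: fock_actP => ? []. Qed.

Local Notation vac := (fock_basis C mset0).

Lemma fock_act_borel (x : borel w1) : fock_act (borel_val x) vac = chi phi x *: vac.
Proof.
have vac_linear : linear (fun z : C^o => z *: vac).
  by move=> a z z'; rewrite scalerDl -scalerA.
rewrite [RHS](linear_hext _ _ vac_linear).
rewrite /fock_act; apply: eq_hext => i ix.
have /hspanP /(_ i ix) := valP x.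
(* Negative indices lie outside the Borel part. For positive ones the multiplicity in the empty
   multiset is 0. *)
case: i {ix} => [[[|k]|k]|] /= k0; [by []| |by []|by []].
by rewrite annihilation_basis mset0E !scale0r scaler0.
Qed.

(** The vacuum spans a copy of C_phi under U(H_+ + H_0); this is what balances the pairing that
    defines [verma_to_fock]. *)
Lemma fock_envel_borel (u : envel (borel w1)) :
  fock_envel (borel_incl u) vac = (ulift (chi phi) u : C) *: vac.
Proof.
elim/envelP: u => t; rewrite uliftE /borel_incl uliftE.
elim: t => [k|x|s IHs t IHt|s IHs t IHt] /=.
- by rewrite fock_envel_alg [k%:A]mulr1.
- by rewrite [LHS]fock_envel_gen fock_act_borel.
- by rewrite fock_envelD IHs IHt scalerDl.
- rewrite fock_envelM IHt (GRing.scalable_linear (fock_envel_linear _)) IHs.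
  apply: etrans (scalerA _ _ _) _.
  exact: (congr1 (fun c : C => c *: vac) (mulrC _ _)).
Qed.

End FockRepresentation.

(** * The morphism from the Verma module to Fock space *)

Section VermaToFock.
Variables (R : realType) (w1 : R) (phi : {scalar cartan w1}).
Local Notation C := R[i].
Local Notation fock := (fock C).
Local Notation vac := (fock_basis C mset0).

(** Frobenius reciprocity for the highest-weight vector [vac]. *)
Definition verma_to_fock : verma phi -> fock :=
  @induced_lift _ _ (borel_incl (w1 := w1)) (Cphi phi) fock
    (fun u (z : Cphi phi) => (z : C) *: fock_envel phi u vac).

(** [gDl], [gDr] and [gA] are the conditions under which a function of pairs factors through the
    tensor product. *)
Let gDl (u u' : envel (heis w1)) (z : Cphi phi) :
  (z : C) *: fock_envel phi (u + u') vac
    = (z : C) *: fock_envel phi u vac + (z : C) *: fock_envel phi u' vac.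
Proof. by rewrite fock_envelD scalerDr. Qed.

Let gDr (u : envel (heis w1)) (z z' : Cphi phi) :
  ((z + z' : Cphi phi) : C) *: fock_envel phi u vac
    = (z : C) *: fock_envel phi u vac + (z' : C) *: fock_envel phi u vac.
Proof. exact: scalerDl. Qed.

Let gA (u : envel (heis w1)) (a : envel (borel w1)) (z : Cphi phi) :
  (z : C) *: fock_envel phi (u * borel_incl a) vac
    = ((a *: z : Cphi phi) : C) *: fock_envel phi u vac.
Proof.
rewrite fock_envelM fock_envel_borel.
rewrite (GRing.scalable_linear (fock_envel_linear _ _)) scalerA.
exact: (congr1 (fun c : C => c *: fock_envel phi u vac) (mulrC _ _)).
Qed.

Lemma verma_to_fock_tens u (z : Cphi phi) :
  verma_to_fock (tens (borel_incl (w1 := w1)) u z)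
    = (z : C) *: fock_envel phi u vac.
Proof. exact: induced_lift_tens. Qed.

Lemma verma_to_fockD v w :
  verma_to_fock (v + w) = verma_to_fock v + verma_to_fock w.
Proof. exact: induced_liftD. Qed.

Lemma verma_to_fock0 : verma_to_fock 0 = 0.
Proof.
by apply: (addIr (verma_to_fock 0)); rewrite -verma_to_fockD !add0r.
Qed.

Lemma verma_to_fockN v : verma_to_fock (- v) = - verma_to_fock v.
Proof.
by apply: (addIr (verma_to_fock v)); rewrite -verma_to_fockD !addNr verma_to_fock0.
Qed.

Lemma verma_to_fock_act u v :
  verma_to_fock (uact u v) = fock_envel phi u (verma_to_fock v).
Proof.
elim/induced_ind: v => [|v IH|v w IHv IHw|u' z].
- by rewrite [uact u 0]scaler0 verma_to_fock0 linear0.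
- by rewrite [uact u _]scalerN [LHS]verma_to_fockN IH verma_to_fockN linearN.
- by rewrite [uact u _]scalerDr [LHS]verma_to_fockD IHv IHw verma_to_fockD linearD.
- rewrite [uact u _]scale_tens !verma_to_fock_tens fock_envelM.
  by rewrite (GRing.scalable_linear (fock_envel_linear _ _)).
Qed.

End VermaToFock.

(** * Commutation relations and PBW spanning in the Verma module *)

Section VermaModule.
Variables (R : realType) (w1 : R) (phi : {scalar cartan w1}).
Local Notation C := R[i].
Local Notation q := (qphi phi).
Local Notation b k := (ugen (@hb R w1 k)).
Implicit Types (u : envel (heis w1)) (v w : verma phi) (la : seq nat).

Lemma uactM u u' v : uact (u * u') v = uact u (uact u' v).
Proof. by rewrite /uact /act scalerA. Qed.

Lemma uactDl u u' v : uact (u + u') v = uact u v + uact u' v.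
Proof. exact: (@scalerDl _ (induced _ _)). Qed.

Lemma uactZl a u v : uact (a *: u) v = a *: uact u v.
Proof. by rewrite -mulr_algl uactM. Qed.

Lemma uact_linear u : linear (@uact _ _ phi u).
Proof.
move=> a v w; rewrite [LHS](@scalerDr _ (induced _ _)); congr (_ + _).
(* By restriction of scalars, scaling by [a] is the action of [a%:A]. *)
by rewrite -[a *: v]/(uact a%:A v) -[LHS]uactM mulr_algr uactZl.
Qed.

HB.instance Definition _ u :=
  GRing.isLinear.Build C (verma phi) (verma phi) *:%R (uact u) (uact_linear u).

Lemma uact_swap (x y : heis w1) v :
  uact (ugen x) (uact (ugen y) v)
    = uact (ugen y) (uact (ugen x) v) + uact (ugen (bracket x y)) v.
Proof. by rewrite -!uactM -uactDl ugen_lie addrC subrK. Qed.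

Lemma uact_gen0 v : uact (ugen (0 : heis w1)) v = 0.
Proof. by rewrite linear0 [LHS]scale0r. Qed.

Lemma pbw_nil : pbw phi [::] = vphi phi.
Proof. by rewrite /pbw big_nil [LHS]scale1r. Qed.

Lemma pbw_cons k la : pbw phi (k :: la) = uact (b (- k%:Z)) (pbw phi la).
Proof. by rewrite /pbw big_cons uactM. Qed.

Lemma tens1_scale (z : C) :
  tens (borel_incl (w1 := w1)) 1 (z : Cphi phi) = z *: vphi phi.
Proof.
rewrite -[z *: _]/(uact z%:A _) [RHS]scale_tens mulr1.
(* The scalar is written as an element of U(H_+ + H_0) so that it can cross the tensor sign. *)
have -> : z%:A = 1 * borel_incl (w1 := w1) z%:A.
  by rewrite mul1r /borel_incl linearZ /= rmorph1.
rewrite tensA; congr tens.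
rewrite -[_ *: _]/(ulift (chi phi) z%:A * 1 : C^o) mulr1 linearZ /= rmorph1.
by rewrite [RHS]mulr1.
Qed.

Lemma uact_borel_vphi (x : borel w1) :
  uact (ugen (borel_val x)) (vphi phi) = chi phi x *: vphi phi.
Proof.
rewrite -tens1_scale [LHS]scale_tens mulr1.
have -> : ugen (borel_val x) = 1 * borel_incl (ugen x).
  by rewrite mul1r /borel_incl ulift_gen.
rewrite tensA; congr tens.
by rewrite -[_ *: _]/(ulift (chi phi) (ugen x) * 1 : C^o) mulr1 ulift_gen.
Qed.

Lemma uact_basis_vphi i : borel_index i ->
  uact (ugen (hbasis w1 i)) (vphi phi) = chi_basis phi i *: vphi phi.
Proof.
move=> bi; pose x : borel w1 := exist _ (hbasis w1 i) (hbasis_hspan w1 bi).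
by rewrite (uact_borel_vphi x) /chi hext_hbasis.
Qed.

(** b_0 and [c] are central in H, so they move past all factors to [vphi], where they act by the
    character. *)
Lemma uact_central_pbw (i : option int) (la : seq nat) :
  i \in [:: Some 0; None] ->
  uact (ugen (hbasis w1 i)) (pbw phi la) = chi_basis phi i *: pbw phi la.
Proof.
move=> ci; have bi : borel_index i by move: ci; rewrite !inE => /orP[]/eqP->.
elim: la => [|k la IH].
  by rewrite pbw_nil uact_basis_vphi.
rewrite pbw_cons uact_swap IH linearZ /=.
suff -> : bracket (hbasis w1 i) (hb w1 (- k%:Z)) = 0 by rewrite uact_gen0 addr0.
rewrite /bracket /= /hbracket !hext_hbasis.
move: ci; rewrite !inE => /orP[]/eqP-> //=.
by rewrite mul0r scale0r if_same.
Qed.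

(** Zero indices are included, so that [perm_pbw] holds for arbitrary sequences; the bracket at
    [k = l = 0] vanishes through its factor k. *)
Lemma uact_neg_swap (k l : nat) v :
  uact (b (- k%:Z)) (uact (b (- l%:Z)) v) = uact (b (- l%:Z)) (uact (b (- k%:Z)) v).
Proof.
rewrite uact_swap [bracket _ _]hbracket_hb -opprD oppr_eq0 -PoszD eqz_nat.
rewrite addn_eq0; case: k => [|k] /=; last by rewrite uact_gen0 addr0.
by rewrite oppr0 mul0r scale0r if_same uact_gen0 addr0.
Qed.

(** On PBW vectors [c] acts by phi(c), which turns k w1 c into the scalar k q. *)
Lemma uact_pos_neg (k l : nat) (la : seq nat) :
  uact (b k%:Z) (uact (b (- l%:Z)) (pbw phi la))
    = uact (b (- l%:Z)) (uact (b k%:Z) (pbw phi la))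
      + ((k == l)%:R * k%:R * q) *: pbw phi la.
Proof.
rewrite uact_swap [bracket _ _]hbracket_hb subr_eq0 eqz_nat.
case: (k == l); last by rewrite uact_gen0 !mul0r scale0r.
rewrite linearZ uactZl; congr (_ + _).
rewrite (@uact_central_pbw None) ?inE ?orbT //.
by apply: etrans (scalerA _ _ _) _; rewrite mul1r -mulrA.
Qed.

Lemma perm_pbw la la' : perm_eq la la' -> pbw phi la = pbw phi la'.
Proof.
have pbw_mid s1 x s2 : pbw phi (s1 ++ x :: s2) = pbw phi (x :: s1 ++ s2).
  by elim: s1 => //= y s1 IH; rewrite pbw_cons IH !pbw_cons uact_neg_swap.
elim: la la' => [|x la IH] la'.
  by rewrite perm_sym => /perm_nilP ->.
move=> pla; have xla : x \in la' by rewrite -(perm_mem pla) mem_head.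
case/splitPr: xla pla => s1 s2 pla; rewrite pbw_mid !pbw_cons (IH (s1 ++ s2)) //.
by rewrite -(perm_cons x) (perm_trans pla) // -cat1s perm_catCA.
Qed.

Lemma partition_sort (la : seq nat) :
  (0 \notin la)%N -> is_partition (sort geq la).
Proof.
move=> la0; rewrite /is_partition mem_sort la0 andbT sort_sorted //.
Qed.

(* [S] in the proof is the span of the PBW vectors, encoded as the intersection of
   all linearly closed predicates containing them. *)
Lemma verma_pbw_ind (P : verma phi -> Prop) :
  (forall a v w, P v -> P w -> P (a *: v + w)) ->
  (forall la, is_partition la -> P (pbw phi la)) -> forall v, P v.
Proof.
move=> PD Ppbw v; pose S v := forall Q : verma phi -> Prop,
  (forall a v w, Q v -> Q w -> Q (a *: v + w)) ->
  (forall la, is_partition la -> Q (pbw phi la)) -> Q v.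
(* The span, unlike an arbitrary [P], can be shown stable under U(H). *)
suff Sv : S v by exact: Sv.
have SP a v1 v2 : S v1 -> S v2 -> S (a *: v1 + v2).
  by move=> Sv Sw Q QD Qpbw; exact: (QD _ _ _ (Sv Q QD Qpbw) (Sw Q QD Qpbw)).
have Spbw la : (0 \notin la)%N -> S (pbw phi la).
  move=> la0 Q QD Qpbw; have := Qpbw _ (partition_sort la0).
  by rewrite (@perm_pbw _ la) // perm_sort.
(* The closure property yields 0 only from a vector already in the span. *)
have S0 : S 0.
  by have := SP (-1) _ _ (@Spbw [::] isT) (@Spbw [::] isT); rewrite scaleN1r addNr.
have SZ a v' : S v' -> S (a *: v') by move=> Sv; rewrite -[_ *: _]addr0; exact: SP.
have SD v1 v2 : S v1 -> S v2 -> S (v1 + v2).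
  by move=> Sv Sw; rewrite -[v1]scale1r; exact: SP.
(* By linearity, stability of the span under [u] need only be tested on PBW vectors. *)
have Slin u : (forall la, is_partition la -> S (uact u (pbw phi la))) ->
    forall v, S v -> S (uact u v).
  move=> Su v1 Sv; apply: (Sv (fun v => S (uact u v))) => // a v2 v3 S2 S3.
  by rewrite linearP; exact: SP.
have part0 la : is_partition la -> (0 \notin la)%N by case/andP.
have Sneg (k : nat) v' : (0 < k)%N -> S v' -> S (uact (b (- k%:Z)) v').
  move=> k0; apply: Slin => la /part0 la0; rewrite -pbw_cons; apply: Spbw.
  by rewrite inE negb_or la0 andbT eq_sym -lt0n.
(* b_k moves right past each factor at the cost of a multiple of a shorter PBW vector, and finally
   kills [vphi]. *)
have Spos (k : nat) la : (0 < k)%N -> (0 \notin la)%N ->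
    S (uact (b k%:Z) (pbw phi la)).
  move=> k0; elim: la => [_|l la IH].
    rewrite pbw_nil uact_basis_vphi //= eqz_nat.
    by rewrite -[k == 0]negbK -lt0n k0 /= scale0r.
  rewrite inE negb_or eq_sym -lt0n => /andP[l0 la0].
  rewrite pbw_cons uact_pos_neg; apply: SD.
    by apply: (Sneg _ _ l0); exact: IH.
  apply: SZ; exact: Spbw.
have Sbasis i v' : S v' -> S (uact (ugen (hbasis w1 i)) v').
  apply: Slin => la /part0 la0.
  have [ci|] := boolP (i \in [:: Some 0; None]).
    by rewrite uact_central_pbw //; apply: SZ; exact: Spbw.
  case: i => [[[|k]|k]|] // _; first exact: Spos.
  by rewrite -/(hb w1 _) NegzE; apply: Sneg => //; exact: Spbw.
have Sgen x v' : S v' -> S (uact (ugen x) v').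
  move=> Sv; rewrite (_ : x = hext (hbasis w1) x); last first.
    rewrite [LHS]monalgE; apply: eq_bigr => i _.
    by apply/malgP => j; rewrite mcoeffZ !mcoeffU mulr_natr.
  rewrite (linear_hext _ _ (ugen_linear (L := heis w1))) /hext.
  elim: (hsupp x : seq _) => [|i s IH].
    by rewrite big_nil [uact 0 v']scale0r; exact: S0.
  by rewrite big_cons uactDl uactZl; apply: SP; [exact: Sbasis|exact: IH].
have Suact u v' : S v' -> S (uact u v').
  elim/envelP: u => t; elim: t v' => [k|x|s IHs t IHt|s IHs t IHt] v' Sv.
  - rewrite (_ : upi _ = k%:A) ?uactZl ?[uact 1 v']scale1r; first by apply: SZ.
    exact/esym/(@mulr1 (envel (heis w1)) (uconst _ k)).
  - exact: Sgen.
  - by rewrite -uaddE [uact _ v']uactDl; apply: SD; [exact: IHs|exact: IHt].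
  - by rewrite -umulE [uact _ v']uactM; apply: IHs; exact: IHt.
elim/induced_ind: v => [|v|v w|u z].
- exact: S0.
- by move=> /(SZ (-1)); rewrite scaleN1r.
- exact: SD.
(* A pure tensor is [u] acting on a multiple of [vphi]. *)
- rewrite -[u]mulr1 -scale_tens; apply: Suact.
  by rewrite tens1_scale -pbw_nil; apply: SZ; exact: (@Spbw [::]).
Qed.

End VermaModule.

(** * Existence and uniqueness of psi, and its values on weight spaces *)

Section PsiMap.
Variables (R : realType) (w1 : R) (phi : {scalar cartan w1}).
Local Notation C := R[i].

Fact verma_to_fock_linear : linear (@verma_to_fock _ _ phi).
Proof.
move=> a v w; rewrite verma_to_fockD; congr (_ + _).
by rewrite -[a *: v]/(uact a%:A v) verma_to_fock_act fock_envel_alg.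
Qed.

HB.instance Definition _ := GRing.isLinear.Build C (verma phi) (fock C) *:%R
  (@verma_to_fock _ _ phi) verma_to_fock_linear.

(** Each b_{-k} with [k] nonzero multiplies by x_k. An entry 0 is excluded because b_0 acts by a
    scalar instead. *)
Lemma verma_to_fock_pbw (la : seq nat) : (0 \notin la)%N ->
  verma_to_fock (pbw phi la) = fock_basis C (seq_mset la).
Proof.
rewrite -creation_seq; elim: la => [_|k la IH].
  rewrite pbw_nil verma_to_fock_tens scale1r /=.
  by have := fock_envel_alg phi 1 (fock_basis C mset0); rewrite !scale1r.
rewrite inE negb_or => /andP[k0 la0].
rewrite pbw_cons verma_to_fock_act IH // fock_envel_gen /fock_act /hb hext_hbasis.
by case: k k0.
Qed.

(** This is psi: b_{-la} v goes to the monomial x^la, then to zeta^|la|. *)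
Definition level_weight : verma phi -> {poly C} :=
  @fock_weight C \o @verma_to_fock _ _ phi.

HB.instance Definition _ := GRing.Linear.on level_weight.

Lemma level_weight_spec : psi_spec level_weight.
Proof.
move=> la /andP[_ la0].
by rewrite /level_weight /= verma_to_fock_pbw ?fock_weight_seq.
Qed.

Lemma psi_spec_unique (psi psi' : {linear verma phi -> {poly C}}) :
  psi_spec psi -> psi_spec psi' -> psi' =1 psi.
Proof.
move=> psiP psiP'; elim/verma_pbw_ind => [a v w|la la_part].
  by rewrite !linearP => -> ->.
by rewrite psiP ?psiP'.
Qed.

Lemma psi_level (psi : {linear verma phi -> {poly C}}) (n : nat) :
  psi_spec psi -> psi @` level phi n = line 'X^n.
Proof.
move=> psiP; have psi_pbw (p : Defs.partn n) : psi (pbw phi (partn_seq p)) = 'X^n.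
  by have /andP[part_p /eqP sum_p] := valP p; rewrite psiP // sum_p.
apply/seteqP; split=> [_ [_ [a ->] <-]|_ [a _ <-]].
  exists (\sum_p a p) => //; rewrite linear_sum scaler_suml.
  by apply: eq_bigr => p _; rewrite linearZ /= psi_pbw.
(* The one-part partition witnesses that the level is not zero; for [n = 0] it must be empty, since
   parts are positive. *)
have [p _] : exists p : Defs.partn n,
    partn_seq p = (if n is 0%N then [::] else [:: n]).
  by apply: partn_seqP; case: (n) => //= k; rewrite addn0.
exists (a *: pbw phi (partn_seq p)); last by rewrite linearZ /= psi_pbw.
exists (fun p' => if p' == p then a else 0).
rewrite (bigD1 p) //= eqxx big1 ?addr0 // => p' /negPf ->.
by rewrite scale0r.
Qed.

End PsiMap.

(** * Regularity, and the eigenvalues of L_0 and Omega *)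

Section Shapovalov.
Variables (R : realType) (w1 : R) (phi : {scalar cartan w1}).
Local Notation C := R[i].
Local Notation q := (qphi phi).
Local Notation b k := (ugen (@hb R w1 k)).
Implicit Types (v w : verma phi) (la : seq nat).

Lemma uact_pos_vphi (k : nat) : (0 < k)%N -> uact (b k%:Z) (vphi phi) = 0.
Proof.
move=> k0; rewrite uact_basis_vphi //= eqz_nat.
by rewrite -[k == 0]negbK -lt0n k0 /= scale0r.
Qed.

Lemma leq_sumn (k : nat) la : k \in la -> (k <= sumn la)%N.
Proof.
elim: la => //= x la IH; rewrite inE => /orP[/eqP ->|/IH kle].
  exact: leq_addr.
exact: leq_trans kle (leq_addl _ _).
Qed.

Lemma partition1 la : is_partition la -> sumn la = 1%N -> la = [:: 1%N].
Proof.
case/andP => _; case: la => [|x [|y la]] //=; first by rewrite addn0 => _ ->.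
by rewrite !inE; case: x y => [|x] [|y] //= _ /eqP; rewrite !addSn !addnS.
Qed.

(* The level-1 Gram matrix is the 1 x 1 matrix with entry q. *)
Lemma shapovalov_regular_qphi : shapovalov_regular phi -> q != 0.
Proof.
case=> S [Ssym Slin _ Sadj _] /(_ 1%N isT); apply: contraNneq => q0.
(* By adjunction the entry is S(v, b_1 b_{-1} v) = q S(v, v), which vanishes when q does. *)
have gram0 i j : gram S 1 i j = 0.
  rewrite mxE.
  have pE (p : Defs.partn 1) : partn_seq p = [:: 1%N].
    by have /andP[part_p /eqP sum_p] := valP p; exact: partition1.
  rewrite !pE pbw_cons pbw_nil Sadj uomega_hb opprK -{2}pbw_nil uact_pos_neg.
  rewrite pbw_nil uact_pos_vphi // linear0 q0 mulr0 scale0r addr0.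
  (* Linearity in the first argument at 0, carried to the second by symmetry, gives S(v, 0) = 0. *)
  have := Slin (vphi phi) (-1) 0 0.
  by rewrite scaleN1r addNr mulN1r addNr Ssym.
(* A row is exhibited because an empty matrix would have determinant 1. *)
have [p _] : exists p : Defs.partn 1, partn_seq p = [:: 1%N] by exact: partn_seqP.
rewrite (expand_det_row _ (enum_rank p)) big1 // => j _.
by rewrite gram0 mul0r.
Qed.

Definition Lterm (k : nat) v : verma phi := uact (b (- k%:Z) * b k%:Z) v.

HB.instance Definition _ k := GRing.isLinear.Build C (verma phi) (verma phi) *:%R
  (Lterm k) (uact_linear _).

(** Moving b_k to the right adds k q for every factor b_{-k}, and b_k kills [vphi] in the end. *)
Lemma Lterm_pbw k la : (0 < k)%N ->
  Lterm k (pbw phi la) = (q * (k * count_mem k la)%:R) *: pbw phi la.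
Proof.
move=> k0; rewrite /Lterm uactM; elim: la => [|l la IH].
  by rewrite pbw_nil uact_pos_vphi // linear0 muln0 mulr0 scale0r.
rewrite pbw_cons uact_pos_neg linearD linearZ /= uact_neg_swap IH linearZ /=.
rewrite mulnDr natrD mulrDr scalerDl addrC -pbw_cons; congr (_ + _).
rewrite eq_sym; have [->|_] := eqVneq l k; last first.
  by rewrite !mul0r muln0 mulr0 !scale0r.
by rewrite mul1r muln1 mulrC pbw_cons.
Qed.

(** Ensures that [Lsum] never takes its default value for infinite support. Parts of [la] are at
    most |la|, and a maximum of bounds serves linear combinations. *)
Lemma Lterm_eventually0 v : exists N, forall k, (N < k)%N -> Lterm k v = 0.
Proof.
elim/verma_pbw_ind: v => [a v w [N HN] [M HM]|la _].
  exists (maxn N M) => k; rewrite gtn_max => /andP[Nk Mk].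
  by rewrite linearP /= HN // HM // scaler0 addr0.
exists (sumn la) => k lak; rewrite Lterm_pbw ?(leq_ltn_trans _ lak) //.
suff /count_memPn -> : k \notin la by rewrite muln0 mulr0 scale0r.
by apply: contraL lak => kla; rewrite -leqNgt; exact: leq_sumn.
Qed.

(** The bound [N] is left free so that several vectors can be summed over one common range. *)
Lemma LsumE N v : (forall k, (N < k)%N -> Lterm k v = 0) ->
  Lsum v = \sum_(0 <= k < N.+1 | (0 < k)%N) Lterm k v.
Proof.
move=> HN; rewrite bigfs ?iota_uniq // => k _.
by rewrite mem_index_iota -leqNgt; exact: HN.
Qed.

Fact Lsum_linear : linear (@Lsum _ _ phi).
Proof.
move=> a v w; have [N HN] := Lterm_eventually0 v.
have [M HM] := Lterm_eventually0 w.
have vN k : (maxn N M < k)%N -> Lterm k v = 0.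
  by rewrite gtn_max => /andP[/HN].
have wM k : (maxn N M < k)%N -> Lterm k w = 0.
  by rewrite gtn_max => /andP[_ /HM].
rewrite (LsumE vN) (LsumE wM) (@LsumE (maxn N M)).
  by rewrite scaler_sumr -big_split; apply: eq_bigr => k _; exact: linearP.
by move=> k lt_k; rewrite linearP /= vN // wM // scaler0 addr0.
Qed.

HB.instance Definition _ :=
  GRing.isLinear.Build C (verma phi) (verma phi) *:%R (@Lsum _ _ phi) Lsum_linear.

Lemma sum_count_mem N la : (forall k, (N < k)%N -> k \notin la) ->
  (\sum_(0 <= k < N.+1 | (0 < k)%N) k * count_mem k la = sumn la)%N.
Proof.
elim: la => [|x la IH] HN; first by rewrite big1 // => k _; rewrite muln0.
under eq_bigr do rewrite /= mulnDr.
rewrite big_split /= IH; last first.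
  by move=> k /HN; rewrite inE negb_or => /andP[].
congr (_ + _)%N; have xN : (x < N.+1)%N.
  by rewrite ltnNge; apply/negP => /HN; rewrite mem_head.
rewrite big_mkcond (bigD1_seq x) ?iota_uniq ?mem_index_iota //= eqxx muln1.
(* An entry [x = 0] is filtered out of the sum, but its contribution is 0 as well. *)
rewrite big1 ?addn0; first by case: (x).
by move=> k kx; rewrite eq_sym (negPf kx) muln0 if_same.
Qed.

Lemma Lsum_pbw la : Lsum (pbw phi la) = (q * (sumn la)%:R) *: pbw phi la.
Proof.
have notin_la k : (sumn la < k)%N -> k \notin la.
  by move=> lak; apply: contraL lak => kla; rewrite -leqNgt; exact: leq_sumn.
have L0 k : (sumn la < k)%N -> Lterm k (pbw phi la) = 0.
  move=> lak; rewrite Lterm_pbw ?(leq_ltn_trans _ lak) //.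
  by have /count_memPn -> := notin_la k lak; rewrite muln0 mulr0 scale0r.
rewrite (LsumE L0) -[in RHS](sum_count_mem notin_la) natr_sum mulr_sumr scaler_suml.
by apply: eq_bigr => k k0; exact: Lterm_pbw.
Qed.

Fact L0_linear : linear (@L0 _ _ phi).
Proof.
by move=> a v w; rewrite /L0 Lsum_linear scalerDr !scalerA [q^-1 * a]mulrC.
Qed.

HB.instance Definition _ :=
  GRing.isLinear.Build C (verma phi) (verma phi) *:%R (@L0 _ _ phi) L0_linear.

Lemma Omega_linear : linear (@Omega _ _ phi).
Proof.
move=> a v w; rewrite /Omega L0_linear addrACA -scalerDr L0_linear.
by rewrite opprD scalerN.
Qed.

Lemma Omega_pbw la : q != 0 ->
  Omega (pbw phi la) = - (sumn la * (sumn la).+1)%:R *: pbw phi la.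
Proof.
(* Regularity enters here: q is invertible, so L_0 has eigenvalue |la|. *)
move=> q0; have L0_pbw : L0 (pbw phi la) = (sumn la)%:R *: pbw phi la.
  by rewrite /L0 Lsum_pbw scalerA mulKf.
rewrite /Omega L0_pbw -[X in _ + X]scale1r -scalerDl natr1.
rewrite [L0 _]linearZ /= L0_pbw scalerA -scaleNr.
by rewrite -natrM mulnC.
Qed.

End Shapovalov.

(** * Linearity of the Legendre operator and the intertwining property *)

Fact legendre_op_linear (F : fieldType) : linear (@legendre_op F).
Proof.
move=> a p r; rewrite /legendre_op derivnD derivnZ derivD derivZ.
rewrite !mulrDr -!scalerAr [2 *: _]scalerDr opprD addrACA; congr (_ + _).
by rewrite scalerBr !scalerA [2 * a]mulrC.
Qed.

HB.instance Definition _ (F : fieldType) :=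
  GRing.isLinear.Build F {poly F} {poly F} *:%R
  (@legendre_op F) (@legendre_op_linear F).

Theorem theorem4p9 (R : realType) (omega1 : R) (omega1_gt0 : 0 < omega1)
    (phi : {scalar cartan omega1}) (hphi : shapovalov_regular phi) :
  (exists psi : {linear verma phi -> {poly R[i]}},
     psi_spec psi /\
     (forall psi' : {linear verma phi -> {poly R[i]}},
        psi_spec psi' -> psi' =1 psi)) /\
  (forall psi : {linear verma phi -> {poly R[i]}}, psi_spec psi ->
     let Phi := fun v : verma phi => Psi (psi v) in
     [/\ (forall p : {poly R[i]}, exists v : verma phi, psi v = p) /\
           (forall n : nat, psi @` level phi n = line 'X^n),
         forall n : nat, Phi @` level phi n = line (legendre R[i] n),
         forall v : verma phi, Phi (Omega v) = legendre_op (Phi v)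
       & forall (n : nat) (v : verma phi), level phi n v ->
           legendre_op (Phi v) = - (n * n.+1)%:R *: Phi v]).
Proof.
split.
  exists (@level_weight _ _ phi); split=> [|psi' psiP'].
    exact: level_weight_spec.
  exact: psi_spec_unique (level_weight_spec phi) psiP'.
move=> psi psiP Phi; have psi_lv n := psi_level n psiP.
have Phi_linear : linear Phi by move=> a v w; rewrite /Phi !linearP.
have Phi_scale n v a : psi v = a *: 'X^n -> Phi v = a *: legendre _ n.
  by move=> Ev; rewrite /Phi Ev linearZ /= Psi_Xn.
split.
(* A polynomial is the sum of its monomial terms, and each term lies in the image of one level. *)
- split=> // p; rewrite -[p]coefK poly_def.
  elim/big_ind: _ => [|_ _ [v <-] [w <-]|i _].
  + by exists 0; rewrite linear0.
  + by exists (v + w); rewrite linearD.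
  + have : line 'X^i (p`_i *: 'X^i) by exists p`_i.
    by rewrite -psi_lv => -[v _ <-]; exists v.
- move=> n; apply/seteqP; split=> [_ [v lv <-]|_ [a _ <-]].
    have [a _ Ea] : line 'X^n (psi v) by rewrite -psi_lv; exists v.
    by exists a => //; rewrite (Phi_scale n v a).
  have : line 'X^n (a *: 'X^n) by exists a.
  rewrite -psi_lv => -[v lv Ev]; exists v => //; exact: Phi_scale.
(* Both sides are linear in [v], so PBW vectors suffice; there the eigenvalues of [Omega] and of
   [legendre_op] agree. *)
- elim/verma_pbw_ind => [a v w IHv IHw|la la_part].
    by rewrite Omega_linear !Phi_linear legendre_op_linear IHv IHw.
  rewrite Omega_pbw ?shapovalov_regular_qphi // /Phi !linearZ /= psiP // Psi_Xn.
  by rewrite legendre_op_legendre.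
- move=> n v lv; have [a _ Ea] : line 'X^n (psi v) by rewrite -psi_lv; exists v.
  rewrite (Phi_scale n v a) // linearZ /= legendre_op_legendre.
  by rewrite !scalerA [a * _]mulrC.
Qed.
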